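(* Let $n\ge1$ and let $[\mathbf i_0]$ be a twisted adapted class of type $A_{2n+1}$. Let $\gamma\in\Phi^+\setminus\Pi$ be an induced vertex of $\Upsilon_{[\mathbf i_0]}$ with $\Omega_{[\mathbf i_0]}(\gamma)=(k,r)$ and $\overline{\mathsf m}(\gamma)=1$. Let $(\alpha,\beta)$ be an $[\mathbf i_0]$-minimal pair for $\gamma$ and set $\Omega_{[\mathbf i_0]}(\alpha)=(i,p)$, $\Omega_{[\mathbf i_0]}(\beta)=(j,q)$. Then one of the following holds: (i) $i=j=n+1$ and $p+q=2r$; (ii) $p-r=|k^--i^-|$, $q-r=-|k^--j^-|$, and $$i^-+j^-=k^-\quad\text{or}\quad(2n+1-i^-)+(2n+1-j^-)=2n+1-k^- .$$ Here $i^-=i-1$ if $i>n+1$ and $i^-=i$ if $i\le n+1$.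
   Context: Let $I=\{1,\dots,2n+1\}$, $W$ the Weyl group of type $A_{2n+1}$ with simple reflections $s_i$, simple roots $\Pi=\{\alpha_i\}$, positive roots $\Phi^+$, longest element $w_0$ of length $N$. Reduced words of $w_0$ are commutation equivalent if related by swapping neighbouring letters $i,j$ with $|i-j|\ge2$; $[\mathbf i]$ is the commutation class. $i$ is a sink (resp. source) of $[\mathbf i]$ if some word in the class starts (resp. ends) with $i$. With $i^*=2n+2-i$, reflection functors: if $i$ is a sink and $i\,i_2\cdots i_N\in[\mathbf i]$, $[\mathbf i]r_i=[i_2\cdots i_N\,i^*]$; if $i$ is a source and $i_1\cdots i_{N-1}i\in[\mathbf i]$, $r_i[\mathbf i]=[i^*i_1\cdots i_{N-1}]$; otherwise unchanged. Put $i^\vee=2n+2-i$; $(\cdot)^{k\vee}$ applies $\vee$ letterwise $k$ times. A class is twisted adapted if obtained by a sequence of reflection functors from the class of the reduced word $\prod_{k=0}^{2n}(1\,2\cdots n{+}1)^{k\vee}$ of $w_0$. For a reduced word $\mathbf j=i_1\cdots i_N$ put $\beta^{\mathbf j}_k=s_{i_1}\cdots s_{i_{k-1}}(\alpha_{i_k})$. The quiver $\Upsilon_{[\mathbf i_0]}$ has vertex set $\Phi^+$; $\beta^{\mathbf i_0}_k$ has residue $i_k$; there is an arrow $\beta_k\to\beta_j$ iff $|i_k-i_j|=1$, $j=\max\{j'<k:i_{j'}=i_j\}$, $k=\min\{k'>j:i_{k'}=i_k\}$. A vertex is induced if its residue is different from $n+1$. Coordinates. Let $P$ delete letters $n+1$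 and replace each letter $j\ge n+2$ by $j-1$. There is a unique Dynkin quiver $Q$ of type $A_{2n}$ such that $P(\mathbf i_0)$ is a reduced word of the longest element of type $A_{2n}$ adapted to $Q$ (each $k$-th letter is a sink of the quiver obtained from $Q$ by reversing successively all arrows at the preceding letters). Fix $\xi$ on vertices of $Q$ with $\xi(j)=\xi(i)+1$ for each arrow $i\to j$. The $k$-th root of residue $i\le n$ (in the order of $\mathbf i_0$) has coordinate $\Omega_{[\mathbf i_0]}=(i,\xi(i)-2(k-1))$; the $k$-th root of residue $i\ge n+2$ has coordinate $(i,\xi(i-1)-2(k-1))$; a root of residue $n+1$ has coordinate $(n+1,p+\frac12)$ if it receives an arrow from a vertex $(j,p)$, and $(n+1,p-\frac12)$ if it has an arrow to a vertex $(j,p)$. Minimal pairs. A sequence is a function $\underline m:\Phi^+\to\mathbb Z_{\ge0}$ with weight $\sum\underline m(\beta)\beta$. $\underline m'<^{\mathtt b}_{\mathbf j}\underline m$ iff there are $k\le s$ with equal values at $\beta^{\mathbf j}_t$ for $t<k$ and $t>s$, and $\underline m'(\beta^{\mathbf j}_k)<\underline m(\beta^{\mathbf j}_k)$, $\underline m'(\beta^{\mathbf j}_s)<\underline m(\beta^{\mathbf j}_s)$; $\underline m'\prec^{\mathtt b}_{[\mathbf i_0]}\underline m$ iff this holds for all $\mathbf j\in[\mathbf i_0]$. A pair $(\alpha,\beta)$ of distinct roots is identified with its indicator function and is written so that $\alpha$ precedes $\beta$ in the order $\beta^{\mathbf j}_1,\dots,\beta^{\mathbf j}_N$ (when $\alpha+\beta\in\Phi^+$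 this does not depend on $\mathbf j\in[\mathbf i_0]$). A root $\gamma$ is identified with its indicator function. A pair $(\alpha,\beta)$ with $\alpha+\beta=\gamma$ is $[\mathbf i_0]$-minimal for $\gamma$ if $\gamma\prec^{\mathtt b}_{[\mathbf i_0]}(\alpha,\beta)$ and there is no sequence $\underline m'$ of weight $\gamma$ with $\gamma\prec^{\mathtt b}_{[\mathbf i_0]}\underline m'\prec^{\mathtt b}_{[\mathbf i_0]}(\alpha,\beta)$. The folded multiplicity of $\gamma=\sum m_i\alpha_i$ is $\overline{\mathsf m}(\gamma)=\max_{\bar i}\sum_{j\in\bar i}m_j$, over the orbits $\bar i=\{i,2n+2-i\}$. *)

(* Defs.v *)
From mathcomp Require Import all_boot all_order all_algebra all_fingroup.

Set Implicit Arguments.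
Unset Strict Implicit.
Unset Printing Implicit Defensive.

Import Order.TTheory GRing.Theory Num.Theory.

Local Open Scope nat_scope.

(* Type A_m. Letters are the natural numbers 1, ..., m. The Weyl group is
   'S_m.+1, acting on the indices 0, ..., m of the vectors ε_0, ..., ε_m; the
   root ε_a - ε_b is encoded by the pair (a, b), so that the simple root
   α_i = ε_(i-1) - ε_i is (i-1, i), and W acts on roots entrywise. *)

Definition is_word (m : nat) (w : seq nat) : bool :=
  all (fun i => 1 <= i <= m) w.

Definition simple_refl (m i : nat) : 'S_m.+1 := tperm (inord i.-1) (inord i).

(* The product of permutations applies its left factor first, hence [rev]:
   [weyl m (i_1 ... i_l)] is x |-> s_{i_1} (... (s_{i_l} x)). *)
Definition weyl (m : nat) (w : seq nat) : 'S_m.+1 :=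
  (\prod_(i <- rev w) simple_refl m i)%g.

Definition reduced (m : nat) (w : seq nat) : Prop :=
  is_word m w /\
  forall v, is_word m v -> weyl m v = weyl m w -> size w <= size v.

Definition longest (m : nat) : 'S_m.+1 := perm (@rev_ord_inj m.+1).

Definition reduced_longest (m : nat) (w : seq nat) : Prop :=
  reduced m w /\ weyl m w = longest m.

(* Positive roots ε_a - ε_b, a < b. *)
Notation posroot m := {ab : 'I_m.+1 * 'I_m.+1 | (ab.1 < ab.2)%N}.

(* Coefficient of γ at the simple root α_(l+1): ε_a - ε_b is
   α_(a+1) + ... + α_b. *)
Definition coef (m : nat) (g : posroot m) (l : 'I_m) : nat :=
  (val g).1 <= l < (val g).2.

Definition rootvec (m : nat) (g : posroot m) : 'rV[int]_m :=
  (\row_l (coef g l)%:Z)%R.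

Definition is_simple (m : nat) (g : posroot m) : Prop :=
  exists l : 'I_m, rootvec g = delta_mx 0%R l.

(* [betas m w] lists the roots s_{i_1} ... s_{i_(k-1)} (α_{i_k}). When w is a
   reduced word of the longest element this lists each positive root once, and
   γ = β_k if and only if [pos w γ] is k-1. *)
Definition beta (m : nat) (w : seq nat) (k : nat) : 'I_m.+1 * 'I_m.+1 :=
  let i := nth 0 w k in
  let s := weyl m (take k w) in
  (s (inord i.-1), s (inord i)).

Definition betas (m : nat) (w : seq nat) : seq ('I_m.+1 * 'I_m.+1) :=
  mkseq (beta m w) (size w).

Definition pos (m : nat) (w : seq nat) (g : posroot m) : nat :=
  index (val g) (betas m w).

Definition residue (m : nat) (w : seq nat) (g : posroot m) : nat :=
  nth 0 w (pos w g).

Definition far (i j : nat) : bool := (i.+1 < j) || (j.+1 < i).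
Definition adjacent (i j : nat) : bool := (i.+1 == j) || (j.+1 == i).

Inductive commeq : seq nat -> seq nat -> Prop :=
| commeq_refl w : commeq w w
| commeq_step u v w i j :
    far i j -> commeq (u ++ j :: i :: v) w -> commeq (u ++ i :: j :: v) w.

(* Commutation classes are handled through representatives: the predicates and
   relations below are invariant under [commeq]. *)
Definition is_sink (i : nat) (w : seq nat) : Prop :=
  exists v, commeq w (i :: v).

Definition is_source (i : nat) (w : seq nat) : Prop :=
  exists v, commeq w (rcons v i).

Definition star (n i : nat) : nat := n.*2.+2 - i.

(* [w'] = [w] r_i *)
Definition refl_right (n i : nat) (w w' : seq nat) : Prop :=
  (exists v, commeq w (i :: v) /\ commeq (rcons v (star n i)) w') \/
  (~ is_sink i w /\ commeq w w').

(* [w'] = r_i [w] *)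
Definition refl_left (n i : nat) (w w' : seq nat) : Prop :=
  (exists v, commeq w (rcons v i) /\ commeq (star n i :: v) w') \/
  (~ is_source i w /\ commeq w w').

Definition vee (n i : nat) : nat := n.*2.+2 - i.

Definition twisted_word (n : nat) : seq nat :=
  flatten [seq map (iter k (vee n)) (iota 1 n.+1) | k <- iota 0 n.*2.+1].

Inductive twisted_adapted (n : nat) : seq nat -> Prop :=
| twisted_base w : commeq (twisted_word n) w -> twisted_adapted n w
| twisted_right w w' i : 1 <= i <= n.*2.+1 ->
    twisted_adapted n w -> refl_right n i w w' -> twisted_adapted n w'
| twisted_left w w' i : 1 <= i <= n.*2.+1 ->
    twisted_adapted n w -> refl_left n i w w' -> twisted_adapted n w'.

Definition arrow (m : nat) (w : seq nat) (g d : posroot m) : Prop :=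
  let k := pos w g in
  let j := pos w d in
  [/\ adjacent (nth 0 w k) (nth 0 w j), j < k,
      forall t, j < t < k -> nth 0 w t <> nth 0 w j &
      forall t, j < t < k -> nth 0 w t <> nth 0 w k].

Definition induced (n : nat) (w : seq nat) (g : posroot n.*2.+1) : Prop :=
  residue w g <> n.+1.

(* A quiver is given by its arrow relation: Q i j means i -> j. *)
Definition dynkin_quiver (m : nat) (Q : rel nat) : Prop :=
  (forall i j, Q i j -> [/\ 1 <= i <= m, 1 <= j <= m & adjacent i j]) /\
  (forall i, 1 <= i < m -> Q i i.+1 (+) Q i.+1 i).

Definition quiver_sink (Q : rel nat) (i : nat) : Prop := forall j, ~~ Q i j.

Definition reverse_at (i : nat) (Q : rel nat) : rel nat :=
  fun a b => if (a == i) || (b == i) then Q b a else Q a b.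

Fixpoint adapted (Q : rel nat) (w : seq nat) : Prop :=
  if w is i :: v then quiver_sink Q i /\ adapted (reverse_at i Q) v else True.

Definition projword (n : nat) (w : seq nat) : seq nat :=
  [seq (if n.+2 <= j then j.-1 else j) | j <- w & j != n.+1].

(* The Dynkin quiver Q determined by the class of w. *)
Definition quiver_of (n : nat) (w : seq nat) (Q : rel nat) : Prop :=
  [/\ dynkin_quiver n.*2 Q, reduced_longest n.*2 (projword n w) &
      adapted Q (projword n w)].

Definition height_function (Q : rel nat) (xi : nat -> int) : Prop :=
  forall i j, Q i j -> xi j = (xi i + 1)%R.

(* The number of earlier roots of the same residue: if γ is the k-th root of
   its residue, then [rank w γ] is k-1. *)
Definition rank (m : nat) (w : seq nat) (g : posroot m) : nat :=
  count_mem (residue w g) (take (pos w g) w).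

(* [has_coord n w xi γ i p]: the coordinate of γ is (i, p). *)
Inductive has_coord (n : nat) (w : seq nat) (xi : nat -> int)
    (g : posroot n.*2.+1) : nat -> rat -> Prop :=
| coord_low : residue w g <= n ->
    has_coord w xi g (residue w g)
      (xi (residue w g) - (2 * rank w g)%:Z)%:~R
| coord_high : n.+2 <= residue w g ->
    has_coord w xi g (residue w g)
      (xi (residue w g).-1 - (2 * rank w g)%:Z)%:~R
| coord_mid_in d j p : residue w g = n.+1 -> arrow w d g ->
    has_coord w xi d j p -> has_coord w xi g n.+1 (p + 1 / 2)%R
| coord_mid_out d j p : residue w g = n.+1 -> arrow w g d ->
    has_coord w xi d j p -> has_coord w xi g n.+1 (p - 1 / 2)%R.

Definition rseq (m : nat) : Type := posroot m -> nat.

Definition weight (m : nat) (f : rseq m) : 'rV[int]_m :=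
  (\sum_(b : posroot m) (f b)%:Z *: rootvec b)%R.

Definition root_seq (m : nat) (g : posroot m) : rseq m :=
  fun d => d == g.

Definition pair_seq (m : nat) (a b : posroot m) : rseq m :=
  fun d => (d == a) || (d == b).

(* m' <^b_w m; the roots β_k and β_s are quantified over instead of the indices
   k and s. *)
Definition bilex (m : nat) (w : seq nat) (f' f : rseq m) : Prop :=
  exists bk bs : posroot m,
    [/\ pos w bk <= pos w bs,
        forall bt, pos w bt < pos w bk \/ pos w bs < pos w bt -> f' bt = f bt,
        f' bk < f bk & f' bs < f bs].

Definition class_bilex (m : nat) (w : seq nat) (f' f : rseq m) : Prop :=
  forall v, commeq w v -> bilex v f' f.

(* (α, β), with α preceding β, is a minimal pair for γ. *)
Definition minimal_pair (m : nat) (w : seq nat) (g a b : posroot m) : Prop :=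
  [/\ (rootvec a + rootvec b)%R = rootvec g, pos w a < pos w b,
      class_bilex w (root_seq g) (pair_seq a b) &
      ~ exists f : rseq m,
          [/\ weight f = rootvec g, class_bilex w (root_seq g) f &
              class_bilex w f (pair_seq a b)]].

(* Maximum over the orbits {j, rev_ord j}; on 0-based indices of simple roots
   [rev_ord] is i |-> 2n+2-i when m = 2n+1. *)
Definition folded_mult (m : nat) (g : posroot m) : nat :=
  \max_(i < m) \sum_(j in [set i; rev_ord i]) coef g j.

Definition minus_res (n i : nat) : nat := if n.+1 < i then i.-1 else i.

(* Main.v *)
Require Import Defs.
From mathcomp Require Import all_boot all_order all_algebra all_fingroup.
From mathcomp Require Import zify lra.

Set Implicit Arguments.
Unset Strict Implicit.
Unset Printing Implicit Defensive.

Import Order.TTheory GRing.Theory Num.Theory.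

(** Reading the letters of a word as crossings turns the word into a wiring
    diagram: wire x starts on level x, a letter i exchanges the wires on the
    levels i-1 and i, and the root of that letter is ε_x - ε_y, where x and y
    are the wires that come from level i-1 and from level i ([beta_crosses]).
    A pair of roots with sum ε_x - ε_y is thus given by a third wire z with
    x < z < y, and the claim compares the places of three crossings.

    In a twisted adapted word w the letters n, n+1, n+2 follow the periodic
    pattern n, n+1, n+2, n+1, ...: a reflection functor only shifts it
    ([twisted_alternating]). Hence one of the wires n and n+1, the middle wire c,
    oscillates between the levels n and n+1 and takes part in exactly the
    crossings n+1. Removing it leaves the wiring diagram of the projected word
    P(w) of type A_{2n} ([level_bump]). So w reverses the order of all wires; as
    w has as many letters as there are pairs of wires, any two wires cross
    exactly once ([alternating_full], [crosses_ltn]), and the crossing of x and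
    y lies between the other two ([crosses_convex]).

    Let h = 2n+1. That P(w) is adapted says that each letter is read at a local
    maximum of the current height function, which then drops by 2 there. In the
    coordinates (row, time) the wires other than c therefore run along straight
    lines of slope 1 or -1, reflected at the rows 0 and h: modulo 2h, a wire has
    an invariant τ with τ = time + row while it climbs and τ = time - row while
    it descends ([intercept_step]). Crossings with c lie on such a line too, in
    the row h/2, which is what the half-integral coordinates of residue n+1
    encode ([has_coordE]). At a crossing the wire from below climbs and the wire
    from above descends ([cross_low], [cross_high]).

    Let γ have coordinate (k, r), let α and β have coordinates (i, p) and (j, q)
    with rows counted in A_{2n}, and suppose that α = ε_x - ε_z. If z is not c,
    the invariants of x, y and z give p + i = r + k, q - j = r - k and
    p - i = q + j modulo 2h. Moreover q < r < p because time decreases along a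
    wire, and p - q <= 2h because a wire meets at most h others and loses at most
    2 units of time each time ([wire_clock_bounds]). These leave only i + j = k,
    p - r = j, r - q = i ([outer_pair]). If z is c, then p and q are the times at
    which x and y are in row h/2, and these lie symmetrically around r
    ([inner_pair]). The case α = ε_z - ε_y is the mirror image under i -> h - i. *)

(** * Wiring diagrams *)

Definition swap (i l : nat) : nat :=
  if l == i.-1 then i else if l == i then i.-1 else l.

(** The simple reflections are applied to the level of a wire in the order of the
    word, so [level u] is the inverse of the Weyl group element of [u]. *)
Definition level (u : seq nat) (x : nat) : nat := foldl (fun l i => swap i l) x u.

Lemma level_rcons u i x : level (rcons u i) x = swap i (level u x).
Proof. by rewrite /level -cats1 foldl_cat. Qed.

Lemma swapK i : involutive (swap i).
Proof.
move=> l; rewrite /swap; case: (l =P i.-1) => ?.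
  by do ![case: eqP => ?]; lia.
by case: (l =P i) => ?; do ![case: eqP => ?]; lia.
Qed.

Lemma level_inj u : injective (level u).
Proof.
elim/last_ind: u => [//|u i IHu] x y; rewrite !level_rcons => /(inv_inj (swapK i)).
exact: IHu.
Qed.

Lemma swap_le m i l : i <= m -> l <= m -> swap i l <= m.
Proof. by rewrite /swap; do 2?case: ifP; lia. Qed.

Lemma is_word_rcons m u i : is_word m (rcons u i) = is_word m u && (1 <= i <= m).
Proof. by rewrite /is_word all_rcons andbC. Qed.

Lemma level_le m u x : is_word m u -> x <= m -> level u x <= m.
Proof.
elim/last_ind: u => [//|u i IHu]; rewrite is_word_rcons level_rcons.
by move=> /andP[/IHu h /andP[_ im]] /h; apply: swap_le.
Qed.

Lemma simple_refl_swap m i l : 1 <= i <= m -> l <= m ->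
  simple_refl m i (inord (swap i l)) = inord l :> 'I_m.+1.
Proof.
move=> /andP[i0 im] lm; rewrite /simple_refl /swap.
have inordE a b : a <= m -> b <= m -> (inord a == inord b :> 'I_m.+1) = (a == b).
  by move=> am bm; rewrite -val_eqE /= !inordK.
have [->|h1] := eqVneq l i.-1; first by rewrite tpermR.
have [->|h2] := eqVneq l i; first by rewrite tpermL.
by rewrite tpermD // inordE; lia.
Qed.

Lemma weyl_level m u (x : 'I_m.+1) : is_word m u ->
  weyl m u (inord (level u x)) = x.
Proof.
elim/last_ind: u => [_|u i IHu].
  by rewrite /weyl big_nil perm1 inord_val.
rewrite is_word_rcons level_rcons => /andP[wu im].
have xm : x <= m by rewrite -ltnS.
rewrite /weyl rev_rcons big_cons permM simple_refl_swap ?level_le //.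
exact: IHu.
Qed.

(** The longest element is an involution, so it makes no difference here that
    [level] inverts the Weyl group element. *)
Lemma level_longest m w x : is_word m w -> weyl m w = longest m ->
  x <= m -> level w x = m - x.
Proof.
move=> ww wl xm; have := @weyl_level m w (inord x) ww.
rewrite wl permE inordK // => /(congr1 val) /=.
rewrite !inordK ?ltnS ?level_le //.
by have := @level_le m w x ww xm; lia.
Qed.

Definition crosses (w : seq nat) (t x y : nat) : Prop :=
  [/\ t < size w, level (take t w) x = (nth 0 w t).-1 &
      level (take t w) y = nth 0 w t].

Definition reverses (m : nat) (w : seq nat) : Prop :=
  is_word m w /\ forall x, x <= m -> level w x = m - x.

Lemma is_word_take m w t : is_word m w -> is_word m (take t w).
Proof. by rewrite /is_word -{1}(cat_take_drop t w) all_cat => /andP[]. Qed.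

Lemma is_word_nth m w t : is_word m w -> t < size w -> 1 <= nth 0 w t <= m.
Proof. by move=> /allP h tw; apply/h/mem_nth. Qed.

Lemma level_take w t x : t < size w ->
  level (take t.+1 w) x = swap (nth 0 w t) (level (take t w) x).
Proof. by move=> tw; rewrite (take_nth 0) // level_rcons. Qed.

Lemma beta_crosses m w t (x y : 'I_m.+1) : is_word m w -> t < size w ->
  (beta m w t == (x, y)) = (level (take t w) x == (nth 0 w t).-1) &&
                         (level (take t w) y == nth 0 w t).
Proof.
move=> ww tw; have wt := @is_word_take m w t ww.
have := @is_word_nth m w t ww tw; set i := nth 0 w t => /andP[i0 im].
have key (z : 'I_m.+1) l : l <= m ->
    (weyl m (take t w) (inord l) == z) = (level (take t w) z == l).
  move=> lm; rewrite -{1}(@weyl_level m _ z wt) (inj_eq perm_inj) -val_eqE /=.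
  by rewrite !inordK ?ltnS ?level_le -1?ltnS // eq_sym.
by rewrite /beta xpair_eqE !key //; lia.
Qed.


Definition inverted (u : seq nat) (x y : nat) : bool := level u y < level u x.

(** Only the exchange of two neighbouring wires can change their relative order. *)
Lemma inverted_step w t x y : t < size w -> x != y ->
  ~~ inverted (take t w) x y -> inverted (take t.+1 w) x y -> crosses w t x y.
Proof.
rewrite /inverted => tw xy; have := @level_inj (take t w) x y.
rewrite !level_take //; set a := level _ x; set b := level _ y => ab.
rewrite /swap /crosses -/a -/b; set i := nth 0 w t.
by do ![case: eqP => ?] => *; split => //; lia.
Qed.

Lemma exists_crossing m w x y : reverses m w -> x < y <= m ->
  exists t, crosses w t x y.
Proof.
move=> [ww wr] /andP[xy ym].
suff H s : s <= size w -> inverted (take s w) x y -> exists t, crosses w t x y.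
  by apply: (H (size w)); rewrite // /inverted take_size !wr; lia.
elim: s => [|s IHs] sw; first by rewrite /inverted take0 /=; lia.
have [/IHs h _|h] := boolP (inverted (take s w) x y); first by apply: h; lia.
by move=> /inverted_step H; exists s; apply: H => //; lia.
Qed.

Lemma card_posroot m : #|{: posroot m}| = 'C(m.+1, 2).
Proof.
rewrite card_sig -sum1_card.
rewrite (eq_bigl (fun ab : 'I_m.+1 * 'I_m.+1 => true && (ab.1 < ab.2))) //.
rewrite -(pair_big_dep xpredT (fun a b : 'I_m.+1 => a < b) (fun _ _ => 1)) /=.
rewrite (exchange_big_dep predT) //= -bin2_sum big_mkord; apply: eq_bigr => b _.
rewrite -(big_ord_widen _ (fun _ => 1)) ?sum1_card ?card_ord //.
by rewrite ltnW.
Qed.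

Lemma crosses_mem_betas m w (x y : 'I_m.+1) : is_word m w ->
  (exists t, crosses w t x y) -> (x, y) \in betas m w.
Proof.
move=> ww [t [tw lx ly]]; apply/mapP; exists t; first by rewrite mem_iota.
by apply/esym/eqP; rewrite beta_crosses // lx ly !eqxx.
Qed.

(** The number of letters is that of pairs of wires; for a word that reverses the
    wires this is what reducedness amounts to. *)
Definition full_reversal (m : nat) (w : seq nat) : Prop :=
  reverses m w /\ size w = 'C(m.+1, 2).

(** Every pair x < y has to cross with x below at least once, so the positive roots
    all occur among the roots of the word. There are as many letters as positive
    roots: hence each occurs once, and nothing else occurs. *)
Lemma crosses_ltn m w t x y : full_reversal m w -> x <= m -> y <= m ->
  crosses w t x y -> x < y.
Proof.
move=> [wr sw] xm ym [tw lx ly]; have [ww _] := wr.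
pose roots := [seq val g | g : posroot m].
have uroots : uniq roots by rewrite map_inj_uniq ?enum_uniq //; apply: val_inj.
have sub : {subset roots <= betas m w}.
  move=> _ /mapP[[[a b] /= ab] _ ->]; apply: crosses_mem_betas => //.
  by apply: (@exists_crossing m) => //; rewrite ab -ltnS ltn_ord.
(* [roots] embeds into the list of roots of w, which is not longer. *)
have szle : size (betas m w) <= size roots.
  by rewrite size_mkseq size_map -cardE card_posroot sw.
have [_ /(_ (inord x, inord y))] := uniq_min_size uroots sub szle.
rewrite crosses_mem_betas //; last by exists t; split; rewrite ?inordK.
by case/mapP=> [[[a b] /= ab] _ [xa yb]]; rewrite -(inordK xm) xa -(inordK ym) yb.
Qed.

Lemma inverted_mono m w s t x y : full_reversal m w -> x < y <= m -> s <= t <= size w ->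
  inverted (take s w) x y -> inverted (take t w) x y.
Proof.
move=> wf /andP[xy ym] /andP[st]; elim: t st => [|t IHt]; first by rewrite leqn0 => /eqP->.
rewrite leq_eqVlt => /orP[/eqP-> //|st] tw Hs.
have Ht := IHt st (ltnW tw) Hs; apply/contraT => h.
suff: crosses w t y x by move/(crosses_ltn wf); lia.
apply: inverted_step => //; first by lia.
  by rewrite /inverted -leqNgt ltnW.
rewrite /inverted in h *; rewrite -leqNgt leq_eqVlt in h.
by case/orP: h => [/eqP/level_inj|//]; lia.
Qed.

Lemma pos_crosses m w (g : posroot m) : reverses m w ->
  crosses w (pos w g) (val g).1 (val g).2.
Proof.
move=> wr; have [ww _] := wr; have := valP g; set x := (val g).1; set y := (val g).2 => xy.
have gin : val g \in betas m w.
  rewrite [val g]surjective_pairing; apply: crosses_mem_betas => //.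
  by apply: (@exists_crossing m) => //; rewrite xy -ltnS ltn_ord.
have tw : pos w g < size w by rewrite -[X in _ < X](size_mkseq (beta m w)) index_mem.
have := nth_index (beta m w 0) gin; rewrite -/(pos w g) nth_mkseq // => /eqP.
by rewrite [val g]surjective_pairing beta_crosses // => /andP[/eqP ? /eqP ?].
Qed.

Lemma inverted_crosses m w t s x y : full_reversal m w -> x < y <= m -> crosses w t x y ->
  s <= size w -> inverted (take s w) x y = (t < s).
Proof.
move=> wf xym [tw lx ly] sw; have wl := is_word_nth (proj1 (proj1 wf)) tw.
have [ts|st] := ltnP t s.
  apply: (inverted_mono wf xym (s := t.+1)); first by rewrite ts.
  by rewrite /inverted !level_take // lx ly /swap; do ![case: eqP => ?]; lia.
apply/negP => /(inverted_mono wf xym (t := t)); rewrite st ltnW // => /(_ isT).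
by rewrite /inverted lx ly; lia.
Qed.

(** When x and y cross they are on neighbouring levels, so z is either below both or
    above both, and has crossed exactly one of them. *)
Lemma crosses_convex m w t1 t2 t x z y : full_reversal m w -> x < z -> z < y -> y <= m ->
  crosses w t x y -> crosses w t1 x z -> crosses w t2 z y ->
  (t1 < t < t2) || (t2 < t < t1).
Proof.
move=> wf xz zy ym cxy cxz czy; have [tw lx ly] := cxy.
have [ww _] := proj1 wf.
have i1 := @inverted_crosses _ _ t1 t x z wf _ cxz (ltnW tw).
have i2 := @inverted_crosses _ _ t2 t z y wf _ czy (ltnW tw).
have n1 : t1 <> t by move=> e; case: cxz; rewrite e lx -ly => _ _ /level_inj; lia.
have n2 : t2 <> t by move=> e; case: czy; rewrite e ly -lx => _ /level_inj; lia.
have wl := is_word_nth ww tw.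
move: i1 i2; rewrite /inverted lx ly.
have := @level_inj (take t w) z x; have := @level_inj (take t w) z y.
rewrite lx ly; lia.
Qed.

(** * Heights, clocks and intercepts in type A_m *)

(** The numerical form of a quiver sink. *)
Definition peak (m : nat) (f : nat -> int) (i : nat) : Prop :=
  [/\ 1 <= i <= m, 1 < i -> f i.-1 = (f i - 1)%R & i < m -> f i.+1 = (f i - 1)%R].

Definition lower (i : nat) (f : nat -> int) : nat -> int :=
  fun l => if l == i then (f i - 2)%R else f l.

(** The wire on level l lies between the rows l and l+1 and takes part in the next
    crossing of these two rows. As time decreases along a word, that is the one with
    the larger height; the bottom wire can only go up, the top wire only down. *)
Definition ascending (m : nat) (f : nat -> int) (l : nat) : bool :=
  (l == 0) || (l < m) && (f l < f l.+1)%R.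

Definition next_row (m : nat) (f : nat -> int) (l : nat) : nat :=
  if ascending m f l then l.+1 else l.

(** The time of the next crossing of the wire on level l. *)
Definition clock (m : nat) (f : nat -> int) (l : nat) : int := f (next_row m f l).

(** The time at which the straight line along which the wire on level l runs at present
    meets row 0; this is the constant τ attached to the wire. *)
Definition intercept (m : nat) (f : nat -> int) (l : nat) : int :=
  (if ascending m f l then clock m f l + (next_row m f l)%:Z
   else clock m f l - (next_row m f l)%:Z)%R.

Lemma ascendingE_below m f i : peak m f i -> ascending m f i.-1.
Proof. by rewrite /ascending => -[i1 h1 h2]; case: i i1 h1 h2 => [|[|i]] //=; lia. Qed.

Lemma ascendingE_above m f i : peak m f i -> ascending m f i = false.
Proof. by rewrite /ascending => -[i1 h1 h2]; lia. Qed.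

Lemma intercept_below m f i : peak m f i -> intercept m f i.-1 = (f i + i%:Z)%R.
Proof.
move=> h; rewrite /intercept /clock /next_row ascendingE_below //.
by case: h => i1 _ _; rewrite prednK; lia.
Qed.

Lemma intercept_above m f i : peak m f i -> intercept m f i = (f i - i%:Z)%R.
Proof. by move=> h; rewrite /intercept /clock /next_row ascendingE_above. Qed.

Lemma clock_below m f i : peak m f i -> clock m f i.-1 = f i.
Proof.
move=> h; rewrite /clock /next_row ascendingE_below //.
by case: h => i1 _ _; rewrite prednK; lia.
Qed.

Lemma clock_above m f i : peak m f i -> clock m f i = f i.
Proof. by move=> h; rewrite /clock /next_row ascendingE_above. Qed.

Lemma lower_eq i f : lower i f i = (f i - 2)%R.
Proof. by rewrite /lower eqxx. Qed.

Lemma lower_neq i f l : l != i -> lower i f l = f l.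
Proof. by rewrite /lower => /negPf->. Qed.

Lemma ascending_lower_above m f i : peak m f i -> ascending m (lower i f) i = (i < m).
Proof.
move=> [i1 _ h2]; rewrite /ascending lower_eq lower_neq; last by lia.
by case: ltnP h2 => [? ->|]; lia.
Qed.

Lemma ascending_lower_below m f i : peak m f i ->
  ascending m (lower i f) i.-1 = (i == 1).
Proof.
move=> [i1 h1 _]; rewrite /ascending prednK; last by lia.
rewrite lower_eq lower_neq; last by lia.
by have [->|] := eqVneq i 1; first by []; lia.
Qed.

Lemma ascending_lower_other m f i l : l != i.-1 -> l != i ->
  ascending m (lower i f) l = ascending m f l.
Proof. by move=> h1 h2; rewrite /ascending !lower_neq //; lia. Qed.

Lemma next_row_lower_other m f i l : l != i.-1 -> l != i ->
  next_row m (lower i f) l = next_row m f l.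
Proof. by move=> h1 h2; rewrite /next_row ascending_lower_other. Qed.

Lemma clock_lower_other m f i l : l != i.-1 -> l != i ->
  clock m (lower i f) l = clock m f l.
Proof.
move=> h1 h2; rewrite /clock next_row_lower_other // lower_neq //.
by rewrite /next_row; case: ifP; lia.
Qed.

Lemma clock_lower_above m f i : peak m f i ->
  clock m (lower i f) i = (if (i < m)%N then f i - 1 else f i - 2)%R.
Proof.
move=> pk; rewrite /clock /next_row ascending_lower_above //; have [i1 _ h2] := pk.
by case: ifP => im; rewrite ?lower_eq // lower_neq ?h2 //; lia.
Qed.

Lemma clock_lower_below m f i : peak m f i ->
  clock m (lower i f) i.-1 = (if i == 1%N then f i - 2 else f i - 1)%R.
Proof.
move=> pk; rewrite /clock /next_row ascending_lower_below //; have [i1 h1 _] := pk.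
case: eqP => i1'; first by rewrite prednK ?lower_eq; lia.
by rewrite lower_neq ?h1; lia.
Qed.

(** Inside the strip a crossing lets both wires continue in their direction, since the
    neighbours of a peak are lower by 1. A wire that reaches the bottom row is
    reflected at row 0 without changing τ, one that reaches the top row is reflected
    at row m+1, and its τ changes by 2(m+1). *)
Lemma intercept_step m f i l : peak m f i -> exists e : int,
  intercept m (lower i f) (swap i l) = (intercept m f l + 2 * (m.+1)%:Z * e)%R.
Proof.
move=> pk; have [i1 h1 h2] := pk; rewrite /swap.
have [->|li1] /= := eqVneq l i.-1.
  rewrite (intercept_below pk) /intercept clock_lower_above // /next_row ascending_lower_above //.
  case: ltnP => im; first by exists 0%R; lia.
  by exists (-1)%R; lia.
have [->|li] /= := eqVneq l i; exists 0%R.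
  rewrite (intercept_above pk) /intercept clock_lower_below // /next_row ascending_lower_below //.
  by case: eqP; lia.
rewrite mulr0 addr0 /intercept clock_lower_other // next_row_lower_other //.
by rewrite ascending_lower_other.
Qed.

Lemma clock_step_other m f i l : l != i.-1 -> l != i ->
  clock m (lower i f) (swap i l) = clock m f l.
Proof. by move=> h1 h2; rewrite /swap (negPf h1) (negPf h2) clock_lower_other. Qed.

(** A crossing costs a wire one unit of time, or two if it is then reflected. *)
Lemma clock_step_cross m f i l : peak m f i -> (l == i.-1) || (l == i) ->
  ((f i - 2 <= clock m (lower i f) (swap i l)) /\
    (clock m (lower i f) (swap i l) < f i))%R.
Proof.
move=> pk; rewrite /swap; case: (l =P i.-1) => [_ _|_ /= ->].
  by rewrite clock_lower_above //; case: ifP; lia.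
by rewrite clock_lower_below //; case: ifP; lia.
Qed.

(** The time at which the next letter [l] of an adapted word is going to be read,
    after the word [u]. *)
Definition height (xi : nat -> int) (u : seq nat) : nat -> int :=
  fun l => (xi l - 2 * (count_mem l u)%:Z)%R.

Lemma height_rcons xi u i : height xi (rcons u i) =1 lower i (height xi u).
Proof.
move=> l; rewrite /height /lower -cats1 count_cat /= addn0 eq_sym.
by case: eqP => [->|_]; lia.
Qed.

Lemma height_cons Q xi i : quiver_sink Q i -> height_function Q xi ->
  height_function (reverse_at i Q) (lower i xi).
Proof.
move=> si hx a b; rewrite /reverse_at /lower.
have [->|ai] := eqVneq a i; have [->|bi] := eqVneq b i => //= q.
- by rewrite (negPf (si i)) in q.
- by have := hx _ _ q; lia.
- by rewrite (negPf (si a)) in q.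
- exact: hx.
Qed.

Lemma dynkin_reverse m Q i : dynkin_quiver m Q -> dynkin_quiver m (reverse_at i Q).
Proof.
move=> [h1 h2]; split=> [a b|l lm]; rewrite /reverse_at.
  by case: ifP => _ /h1 [? ?]; rewrite /adjacent => ?; split => //; lia.
by rewrite [(l.+1 == i) || _]orbC; case: ifP => _; first rewrite addbC; apply: h2.
Qed.

Lemma sink_peak m Q xi i : dynkin_quiver m Q -> height_function Q xi ->
  quiver_sink Q i -> 1 <= i <= m -> peak m xi i.
Proof.
move=> [_ h2] hx si im; split=> // h.
  have /h2 : 1 <= i.-1 < m by lia.
  rewrite prednK; last by lia.
  by rewrite (negPf (si _)) addbF => /hx; lia.
have /h2 : 1 <= i < m by lia.
by rewrite (negPf (si _)) => /hx; lia.
Qed.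

Lemma eq_peak m f f' i : f =1 f' -> peak m f i -> peak m f' i.
Proof. by move=> e [? ? ?]; split => // ?; rewrite -!e; auto. Qed.

Lemma height_lower xi i u : height (lower i xi) u =1 height xi (i :: u).
Proof. by move=> l; rewrite /height /lower /= eq_sym; case: eqP => [->|_]; lia. Qed.

(** Reversing the arrows at a sink i lowers the height function by 2 at i. *)
Lemma adapted_peak m Q xi u i v : dynkin_quiver m Q -> height_function Q xi ->
  is_word m (u ++ i :: v) -> adapted Q (u ++ i :: v) -> peak m (height xi u) i.
Proof.
elim: u Q xi => [|j u IHu] Q xi dQ hx /= /andP[jm wv] [sj ad].
  apply: (@eq_peak _ xi) => [l|]; first by rewrite /height /=; lia.
  exact: (sink_peak dQ).
apply: (eq_peak (height_lower xi j u)).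
exact: (IHu _ _ (dynkin_reverse j dQ) (height_cons sj hx) wv ad).
Qed.

(** * The alternation of the letters n, n+1, n+2 *)

Definition central (n i : nat) : bool := n <= i <= n.+2.

(** The periodic word n, n+1, n+2, n+1, n, ... *)
Definition mid_pattern (n s : nat) : nat :=
  if s %% 2 == 1 then n.+1 else if s %% 4 == 0 then n else n.+2.

Definition central_letters (n : nat) (u : seq nat) : seq nat := [seq i <- u | central n i].

(** [d] is the place in the periodic pattern at which the word starts. The pattern has
    period 4 and w has 4n+2 letters among n, n+1, n+2, so that a shift of the pattern
    by the length of w exchanges n and n+2, as the involution * does. *)
Definition alternating (n d : nat) (w : seq nat) : Prop :=
  [/\ is_word n.*2.+1 w, size w = 'C(n.*2.+2, 2) &
      central_letters n w = mkseq (fun j => mid_pattern n (d + j)) n.*2.+1.*2].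

Lemma mid_pattern_star n s : star n (mid_pattern n s) = mid_pattern n s.+2.
Proof. by rewrite /star /mid_pattern; do !case: eqP; lia. Qed.

Lemma mid_pattern4 n s : mid_pattern n (s + 4) = mid_pattern n s.
Proof. by rewrite /mid_pattern; do !case: eqP; lia. Qed.

Lemma mkseqS_cons (f : nat -> nat) k : mkseq f k.+1 = f 0 :: mkseq (f \o succn) k.
Proof. by rewrite /mkseq /= (iotaDl 1 0) -map_comp. Qed.

Lemma central_letter n u i v f k : central_letters n (u ++ i :: v) = mkseq f k ->
  central n i -> i = f (size (central_letters n u)).
Proof.
move=> tw ci.
have tc : central_letters n (u ++ i :: v) =
    central_letters n u ++ i :: central_letters n v.
  by rewrite /central_letters filter_cat /= ci.
rewrite tc in tw; have sz := congr1 size tw; rewrite size_cat size_mkseq /= in sz.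
have := congr1 (nth 0 ^~ (size (central_letters n u))) tw; rewrite /= nth_cat ltnn subnn /=.
by rewrite nth_mkseq //; lia.
Qed.

(** Of two consecutive letters of the pattern exactly one is n+1, and n+1 does not
    commute with n and n+2. So a commutation never exchanges two of these letters. *)
Lemma alternating_commeq n d w w' : commeq w w' -> alternating n d w -> alternating n d w'.
Proof.
elim=> {w w'} [//|u v w i j fij _ IH] [wu su tu]; apply: IH.
split.
- by move: wu; rewrite /is_word !all_cat /= => /and4P[-> -> -> ->].
- by rewrite -su !size_cat.
rewrite -tu /central_letters !filter_cat /=; case: ifP => cj; case: ifP => ci //.
have ei := central_letter tu ci.
rewrite -cat_rcons in tu; have ej := central_letter tu cj.
move: ei ej fij; rewrite /central_letters filter_rcons ci size_rcons /mid_pattern /far.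
by do !case: eqP; lia.
Qed.

Lemma star_letter n i : 1 <= i <= n.*2.+1 -> 1 <= star n i <= n.*2.+1.
Proof. by rewrite /star; lia. Qed.

Lemma central_star n i : 1 <= i <= n.*2.+1 -> central n (star n i) = central n i.
Proof. by rewrite /star /central; lia. Qed.

Lemma alternating_right n d w w' i : alternating n d w -> refl_right n i w w' ->
  exists d', alternating n d' w'.
Proof.
move=> wr [[v [c1 c2]]|[_ c]]; last by exists d; apply: alternating_commeq c wr.
have [/= /andP[im wv] sv tv] := alternating_commeq c1 wr.
have rot : is_word n.*2.+1 (rcons v (star n i)) /\
           size (rcons v (star n i)) = 'C(n.*2.+2, 2).
  by rewrite is_word_rcons wv star_letter // size_rcons.
move: tv; rewrite /central_letters /=; case: ifP => ci tv.
  exists d.+1; apply: (alternating_commeq c2); split; try by case: rot.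
  move: tv; rewrite doubleS mkseqS_cons addn0 => -[ei tv].
  rewrite /central_letters filter_rcons central_star // ci tv [in RHS]mkseqS ei mid_pattern_star.
  congr (rcons _ _); last by rewrite /= /mid_pattern; do !case: eqP; lia.
  by apply: eq_mkseq => j /=; rewrite addnS.
exists d; apply: (alternating_commeq c2); split; try by case: rot.
by rewrite /central_letters filter_rcons central_star // ci.
Qed.

Lemma alternating_left n d w w' i : alternating n d w -> refl_left n i w w' ->
  exists d', alternating n d' w'.
Proof.
move=> wr [[v [c1 c2]]|[_ c]]; last by exists d; apply: alternating_commeq c wr.
have [] := alternating_commeq c1 wr.
rewrite is_word_rcons size_rcons => /andP[wv im] sv tv.
have rot : is_word n.*2.+1 (star n i :: v) /\ size (star n i :: v) = 'C(n.*2.+2, 2).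
  by rewrite /= star_letter.
move: tv; rewrite /central_letters filter_rcons; case: ifP => ci tv.
  (* d + 3 stands for d - 1 in a pattern of period 4. *)
  exists (d + 3); apply: (alternating_commeq c2); split; try by case: rot.
  move: tv; rewrite doubleS mkseqS => /rcons_inj[tv ei].
  rewrite /central_letters /= central_star // ci tv [in RHS]mkseqS_cons ei mid_pattern_star addn0.
  congr (_ :: _); first by rewrite /mid_pattern; do !case: eqP; lia.
  by apply: eq_mkseq => j /=; rewrite -mid_pattern4; congr mid_pattern; lia.
exists d; apply: (alternating_commeq c2); split; try by case: rot.
by rewrite /central_letters /= central_star // ci.
Qed.

Lemma iter_vee n k j : j <= n.*2.+2 -> iter k (vee n) j = if odd k then vee n j else j.
Proof.
by move=> jn; elim: k => //= k ->; case: (odd k) => //=; rewrite /vee; lia.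
Qed.

(** Each factor (1 2 ... n+1) contributes n, n+1 and its image under the involution
    contributes n+2, n+1. *)
Lemma alternating_twisted_word n : 1 <= n -> alternating n 0 (twisted_word n).
Proof.
move=> n1; rewrite /twisted_word; split.
- apply/allP => j /flattenP[_ /mapP[k _ ->]] /mapP[l]; rewrite mem_iota => l1 ->.
  by rewrite iter_vee; last lia; case: ifP; rewrite /vee; lia.
- rewrite size_flatten /shape -map_comp.
  rewrite (eq_map (g := fun=> n.+1)); last by move=> k /=; rewrite size_map size_iota.
  rewrite sumnE big_map big_const_seq count_predT size_iota iter_addn_0.
  by rewrite bin2 /=; lia.
have block k : central_letters n (map (iter k (vee n)) (iota 1 n.+1)) =
    [:: mid_pattern n k.*2; mid_pattern n k.*2.+1].
  have -> : n.+1 = n.-1 + 2 by lia.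
  rewrite iotaD map_cat /central_letters filter_cat.
  rewrite (@eq_in_filter _ _ pred0) ?filter_pred0 /=; last first.
    move=> x /mapP[l]; rewrite mem_iota => l1 ->; rewrite iter_vee; last by lia.
    by rewrite /central; case: ifP; rewrite /vee; lia.
  rewrite !iter_vee; [|lia..].
  have [e1 e2] : 1 + n.-1 = n /\ (1 + n.-1).+1 = n.+1 by lia.
  have kE := odd_double_half k.
  have c0 : mid_pattern n k.*2 = if odd k then n.+2 else n.
    by rewrite /mid_pattern; case: (odd k) kE => /= kE; do !case: eqP; lia.
  have c1 : mid_pattern n k.*2.+1 = n.+1 by rewrite /mid_pattern; case: eqP; lia.
  rewrite e1 c0 c1 /central /vee; case: (odd k) => /=.
    have -> : n <= n.*2.+2 - n <= n.+2 by lia.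
    have -> : n <= n.*2.+2 - n.+1 <= n.+2 by lia.
    by congr [:: _; _]; lia.
  have -> : n <= n <= n.+2 by lia.
  by have -> : n <= n.+1 <= n.+2 by lia.
elim: (n.*2.+1) => [//|k IHk].
rewrite -[k.+1]addn1 iotaD map_cat flatten_cat /central_letters filter_cat.
rewrite -!/(central_letters n _) IHk.
rewrite (_ : flatten (map _ (iota (0 + k) 1)) = map (iter k (vee n)) (iota 1 n.+1)).
  by rewrite block addn1 doubleS !mkseqS -!cats1 -catA.
by rewrite /= cats0.
Qed.

Lemma twisted_alternating n w : 1 <= n -> twisted_adapted n w -> exists d, alternating n d w.
Proof.
move=> n1; elim=> {w} [w c|w w' i _ _ [d wr]|w w' i _ _ [d wr]].
- by exists 0; apply: alternating_commeq c (alternating_twisted_word n1).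
- exact: (alternating_right wr).
- exact: (alternating_left wr).
Qed.

(** * The middle wire and its removal *)

(** The place in the periodic pattern that is reached after the word [u]. *)
Definition stage (n d : nat) (u : seq nat) : nat := d + size (central_letters n u).

(** The level of the middle wire at stage s: it stays on level n+1 while a letter n is
    read and on level n while a letter n+2 is read, and changes at every letter n+1.
    Wires are named after their initial levels, so [mid_level n d] is also the name of
    the middle wire if d is the stage at the start. *)
Definition mid_level (n s : nat) : nat := if s %% 4 < 2 then n.+1 else n.

Lemma stage_rcons n d u i : stage n d (rcons u i) = stage n d u + central n i.
Proof.
by rewrite /stage /central_letters filter_rcons; case: ifP => _; rewrite ?size_rcons /=; lia.
Qed.

Lemma projword_rcons n u i : projword n (rcons u i) =
  if i == n.+1 then projword n u else rcons (projword n u) (minus_res n i).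
Proof. by rewrite /projword filter_rcons; case: eqP => //= _; rewrite map_rcons. Qed.

Lemma mid_pattern_cases n s i : central n i -> i = mid_pattern n s ->
  [\/ i = n /\ s %% 4 = 0, i = n.+2 /\ s %% 4 = 2, i = n.+1 /\ s %% 4 = 1 |
      i = n.+1 /\ s %% 4 = 3].
Proof.
rewrite /mid_pattern => _; case: eqP => h1; last case: eqP => h2; move=> ->.
- have [?|?] : s %% 4 = 1 \/ s %% 4 = 3 by lia.
    by constructor 3.
  by constructor 4.
- by constructor 1.
- by constructor 2; lia.
Qed.

Lemma swap_mid_level n s i : (central n i -> i = mid_pattern n s) ->
  swap i (mid_level n s) = mid_level n (s + central n i).
Proof.
case: (boolP (central n i)) => ci; last first.
  by move=> _; move: ci; rewrite addn0 /central /swap /mid_level; do !case: ifP; lia.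
move=> /(_ isT) /(mid_pattern_cases ci) H.
by rewrite /swap /mid_level; case: H => -[-> sE]; rewrite -modnDml sE /=; do !case: eqP; lia.
Qed.

Lemma swap_cases i l : [\/ l = i.-1 /\ swap i l = i, l = i /\ swap i l = i.-1 |
  [/\ l <> i.-1, l <> i & swap i l = l]].
Proof.
rewrite /swap; case: eqP => h1; first by constructor 1.
by case: eqP => h2; [constructor 2|constructor 3].
Qed.

Lemma swap_bump_below c i l : 1 <= i < c -> swap i (bump c l) = bump c (swap i l).
Proof.
move=> ic; rewrite /bump.
by case: (swap_cases i ((c <= l) + l)) => -[*]; case: (swap_cases i l) => -[*]; lia.
Qed.

Lemma swap_bump_above c i l : c < i.-1 -> swap i (bump c l) = bump c (swap i.-1 l).
Proof.
move=> ic; rewrite /bump.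
by case: (swap_cases i ((c <= l) + l)) => -[*]; case: (swap_cases i.-1 l) => -[*]; lia.
Qed.

Lemma swap_bump_at c l : swap c.+1 (bump c l) = bump c.+1 l.
Proof. by rewrite /bump; case: (swap_cases c.+1 ((c <= l) + l)) => -[*]; lia. Qed.

Lemma swap_bump_above_at c l : swap c.+1 (bump c.+1 l) = bump c l.
Proof. by rewrite -swap_bump_at swapK. Qed.

Lemma mid_level_below n s i : (central n i -> i = mid_pattern n s) -> i <= n -> i < mid_level n s.
Proof.
move=> H im; have [e|] := eqVneq i n; last by rewrite /mid_level; case: ifP; lia.
have ci : central n i by rewrite /central; lia.
by case: (mid_pattern_cases ci (H ci)) => -[*]; rewrite /mid_level; case: ifP; lia.
Qed.

Lemma mid_level_above n s i : (central n i -> i = mid_pattern n s) -> n.+1 < i ->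
  mid_level n s < i.-1.
Proof.
move=> H im; have [e|] := eqVneq i n.+2; last by rewrite /mid_level; case: ifP; lia.
have ci : central n i by rewrite /central; lia.
by case: (mid_pattern_cases ci (H ci)) => -[*]; rewrite /mid_level; case: ifP; lia.
Qed.

Lemma mid_level_next n s i : (central n i -> i = mid_pattern n s) -> i != n.+1 ->
  mid_level n (s + central n i) = mid_level n s.
Proof.
move=> H ni; case: (boolP (central n i)) => ci; last by rewrite addn0.
by case: (mid_pattern_cases ci (H ci)) => -[*]; rewrite /mid_level; do 2?case: ifP; lia.
Qed.

Lemma mid_level_mid n s : n.+1 = mid_pattern n s ->
  mid_level n s = n.+1 /\ mid_level n s.+1 = n /\ s %% 4 = 1 \/
  mid_level n s = n /\ mid_level n s.+1 = n.+1 /\ s %% 4 = 3.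
Proof.
have c1 : central n n.+1 by rewrite /central; lia.
by move=> /(mid_pattern_cases c1); case=> -[*]; rewrite /mid_level; do 2?case: ifP; lia.
Qed.

(** Removing the middle wire commutes with reading a letter: the letters below n+1 act
    below the middle wire, those above n+1 act above it, and n+1 moves only the middle
    wire with respect to the others. *)
Lemma swap_bump n s i l : 1 <= i -> (central n i -> i = mid_pattern n s) ->
  swap i (bump (mid_level n s) l) =
  bump (mid_level n (s + central n i)) (if i == n.+1 then l else swap (minus_res n i) l).
Proof.
move=> i1 H; have [e|ni] := eqVneq i n.+1.
  have c1 : central n i by rewrite e /central; lia.
  rewrite c1 addn1 e; case: (@mid_level_mid n s); first by rewrite -{1}e H.
    by move=> [-> [-> _]]; rewrite swap_bump_above_at.
  by move=> [-> [-> _]]; rewrite swap_bump_at.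
rewrite mid_level_next // /minus_res; have [im|im] := ltnP n.+1 i.
  by rewrite swap_bump_above // mid_level_above.
by rewrite swap_bump_below // i1 mid_level_below //; lia.
Qed.

Lemma alternating_letter n d w t : alternating n d w -> t < size w -> central n (nth 0 w t) ->
  nth 0 w t = mid_pattern n (stage n d (take t w)).
Proof.
move=> [_ _ tw] ts; apply: (central_letter (v := drop t.+1 w) (k := n.*2.+1.*2)
  (f := fun j => mid_pattern n (d + j))).
by rewrite -drop_nth ?cat_take_drop.
Qed.

Lemma stage_step n d w t : t < size w ->
  stage n d (take t.+1 w) = stage n d (take t w) + central n (nth 0 w t).
Proof. by move=> ts; rewrite (take_nth 0) // stage_rcons. Qed.

Lemma level_mid_wire n d w t : alternating n d w -> t <= size w ->
  level (take t w) (mid_level n d) = mid_level n (stage n d (take t w)).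
Proof.
move=> rw; elim: t => [_|t IHt ts]; first by rewrite take0 /stage addn0.
rewrite level_take // IHt ?(ltnW ts) // stage_step // swap_mid_level //.
exact: alternating_letter.
Qed.

(** With the middle wire removed, a word gives the wiring diagram of its projection. *)
Lemma level_bump n d w t x : alternating n d w -> t <= size w ->
  level (take t w) (bump (mid_level n d) x) =
  bump (mid_level n (stage n d (take t w))) (level (projword n (take t w)) x).
Proof.
move=> rw; elim: t => [_|t IHt ts]; first by rewrite take0 /stage addn0.
have [ww _ _] := rw; have /andP[i1 _] := is_word_nth ww ts.
rewrite level_take // IHt ?(ltnW ts) // stage_step // swap_bump //; last first.
  exact: alternating_letter.
by rewrite (take_nth 0) // projword_rcons; case: eqP => // _; rewrite level_rcons.
Qed.

(** The projection reverses the outer wires; the middle wire makes 2n+1 moves between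
    the levels n and n+1, an odd number, and so ends on the opposite level. *)
Lemma alternating_full n d w : alternating n d w -> reduced_longest n.*2 (projword n w) ->
  full_reversal n.*2.+1 w.
Proof.
move=> rw [[wp _] lp]; have [ww sw tw] := rw; split=> //; split=> // x xm.
have ls := level_mid_wire rw (leqnn _); have lb y := level_bump y rw (leqnn _).
rewrite take_size in ls lb.
(* 4n+2 = 2 modulo 4, and two stages later the middle wire is on the other level. *)
have st : stage n d w = d + 4 * n + 2 by rewrite /stage tw size_mkseq; lia.
have {}st : mid_level n (stage n d w) = n.*2.+1 - mid_level n d.
  by rewrite st /mid_level; do 2!case: ifP; lia.
have [->|xc] := eqVneq x (mid_level n d); first by rewrite ls st.
have sn : n <= mid_level n d <= n.+1 by rewrite /mid_level; case: ifP; lia.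
have ux : unbump (mid_level n d) x <= n.*2.
  by rewrite /unbump; case: ltngtP xc; lia.
rewrite -[x in LHS](@unbumpK (mid_level n d)) // lb st (level_longest wp lp ux).
by move: xc; rewrite /unbump /bump; case: ltngtP; case: leqP; lia.
Qed.

(** * Wires in the projected diagram *)

Definition heights (n : nat) (w : seq nat) (xi : nat -> int) (t : nat) : nat -> int :=
  height xi (projword n (take t w)).

Definition adapted_to (n : nat) (w : seq nat) (Q : rel nat) (xi : nat -> int) : Prop :=
  quiver_of n w Q /\ height_function Q xi.

Lemma eq_next_row m f f' l : f =1 f' -> next_row m f l = next_row m f' l.
Proof. by move=> e; rewrite /next_row /ascending !e. Qed.

Lemma eq_clock m f f' l : f =1 f' -> clock m f l = clock m f' l.
Proof. by move=> e; rewrite /clock (eq_next_row m l e) e. Qed.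

Lemma eq_intercept m f f' l : f =1 f' -> intercept m f l = intercept m f' l.
Proof.
by move=> e; rewrite /intercept (eq_clock m l e) (eq_next_row m l e) /ascending !e.
Qed.

Lemma projword_split n w t : t < size w -> nth 0 w t != n.+1 ->
  projword n w = projword n (take t w) ++
    minus_res n (nth 0 w t) :: projword n (drop t.+1 w).
Proof.
move=> ts ti; rewrite -{1}(cat_take_drop t w) (drop_nth 0) // /projword.
by rewrite filter_cat map_cat /= ti.
Qed.

Lemma heights_peak n w Q xi t : adapted_to n w Q xi -> t < size w ->
  nth 0 w t != n.+1 -> peak n.*2 (heights n w xi t) (minus_res n (nth 0 w t)).
Proof.
move=> [[dQ [[wp _] _] ad] hf] ts ti; rewrite (projword_split ts ti) in wp ad.
exact: adapted_peak dQ hf wp ad.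
Qed.

Lemma heights_mid n w xi t : t < size w -> nth 0 w t = n.+1 ->
  heights n w xi t.+1 = heights n w xi t.
Proof. by move=> ts e; rewrite /heights (take_nth 0) // projword_rcons e eqxx. Qed.

Lemma heights_step n w xi t : t < size w -> nth 0 w t != n.+1 ->
  heights n w xi t.+1 =1 lower (minus_res n (nth 0 w t)) (heights n w xi t).
Proof.
move=> ts /negPf e l; rewrite /heights (take_nth 0) // projword_rcons e.
exact: height_rcons.
Qed.

Definition outer_level (n : nat) (w : seq nat) (t x : nat) : nat :=
  level (projword n (take t w)) x.

Lemma outer_level_mid n w t x : t < size w -> nth 0 w t = n.+1 ->
  outer_level n w t.+1 x = outer_level n w t x.
Proof. by move=> ts e; rewrite /outer_level (take_nth 0) // projword_rcons e eqxx. Qed.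

Lemma outer_level_step n w t x : t < size w -> nth 0 w t != n.+1 ->
  outer_level n w t.+1 x = swap (minus_res n (nth 0 w t)) (outer_level n w t x).
Proof.
by move=> ts /negPf e; rewrite /outer_level (take_nth 0) // projword_rcons e level_rcons.
Qed.

Definition wire_clock n w xi t x : int :=
  clock n.*2 (heights n w xi t) (outer_level n w t x).

Definition wire_intercept n w xi t x : int :=
  intercept n.*2 (heights n w xi t) (outer_level n w t x).

Lemma wire_intercept_mod n w Q xi t x : adapted_to n w Q xi -> t <= size w ->
  exists e : int, wire_intercept n w xi t x =
    (wire_intercept n w xi 0 x + 2 * (n.*2.+1)%:Z * e)%R.
Proof.
move=> H; elim: t => [_|t IHt ts]; first by exists 0%R; rewrite mulr0 addr0.
have [e he] := IHt (ltnW ts).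
have [mid|nmid] := eqVneq (nth 0 w t) n.+1.
  by exists e; rewrite -he /wire_intercept heights_mid // outer_level_mid.
have [e' he'] := intercept_step (outer_level n w t x) (heights_peak H ts nmid).
exists (e + e')%R; rewrite mulrDr addrA -he /wire_intercept -he' outer_level_step //.
exact/eq_intercept/heights_step.
Qed.

Lemma wire_clock_mid n w xi t x : t < size w -> nth 0 w t = n.+1 ->
  wire_clock n w xi t.+1 x = wire_clock n w xi t x.
Proof. by move=> ts e; rewrite /wire_clock heights_mid // outer_level_mid. Qed.

Lemma wire_clock_other n w xi t x : t < size w -> nth 0 w t != n.+1 ->
  outer_level n w t x != (minus_res n (nth 0 w t)).-1 ->
  outer_level n w t x != minus_res n (nth 0 w t) ->
  wire_clock n w xi t.+1 x = wire_clock n w xi t x.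
Proof.
move=> ts e h1 h2; rewrite /wire_clock outer_level_step // -(clock_step_other _ _ h1 h2).
exact/eq_clock/heights_step.
Qed.

Lemma wire_clock_cross n w Q xi t x : adapted_to n w Q xi -> t < size w ->
  let i := minus_res n (nth 0 w t) in
  nth 0 w t != n.+1 -> (outer_level n w t x == i.-1) || (outer_level n w t x == i) ->
  [/\ wire_clock n w xi t x = heights n w xi t i,
     (wire_clock n w xi t.+1 x < wire_clock n w xi t x)%R &
     (wire_clock n w xi t x <= wire_clock n w xi t.+1 x + 2)%R].
Proof.
move=> H ts i e hx; have pk := heights_peak H ts e.
have c0 : wire_clock n w xi t x = heights n w xi t i.
  rewrite /wire_clock; case/orP: hx => /eqP->; first exact: clock_below.
  exact: clock_above.
have := clock_step_cross pk hx; rewrite c0 /wire_clock outer_level_step //.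
rewrite (eq_clock _ _ (heights_step _ ts e)) -/i => -[h1 h2]; split => //.
by move: h1; lia.
Qed.

Lemma minus_res_low n i : i <= n.+1 -> minus_res n i = i.
Proof. by rewrite /minus_res ltnNge => ->. Qed.

Lemma minus_res_high n i : n.+1 < i -> minus_res n i = i.-1.
Proof. by rewrite /minus_res => ->. Qed.

(** Level n of the projected diagram is the only one whose wire can cross the middle
    wire next; this is the clock of that wire. *)
Definition mid_clock n w xi t : int := clock n.*2 (heights n w xi t) n.

Lemma mid_clock_step n d w Q xi t : 1 <= n -> alternating n d w -> adapted_to n w Q xi ->
  t < size w -> mid_clock n w xi t.+1 =
    (mid_clock n w xi t - (central n (nth 0 w t) && (nth 0 w t != n.+1))%:Z)%R.
Proof.
move=> n1 rw H ts; rewrite /mid_clock; have [mid|nmid] := eqVneq (nth 0 w t) n.+1.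
  by rewrite heights_mid // andbF subr0.
rewrite andbT (eq_clock _ _ (heights_step _ ts nmid)).
have := heights_peak H ts nmid; set f := heights n w xi t; rewrite /minus_res.
have [e|e] := eqVneq (nth 0 w t) n.
  rewrite e ltnNge leqnSn /= => pk; rewrite clock_lower_above // (clock_above pk).
  by rewrite /central; case: ifP; lia.
have [e2|e2] := eqVneq (nth 0 w t) n.+2.
  rewrite e2 leqnn /= => pk; have := clock_lower_below pk; have := clock_below pk.
  by rewrite /= /central => -> ->; case: eqP; lia.
move=> pk; rewrite clock_lower_other; [|by case: ifP; lia..].
have -> : central n (nth 0 w t) = false by rewrite /central; lia.
by rewrite subr0.
Qed.

(** The rows n and n+1 of A_{2n} take turns, so each of their crossings advances the
    clock by exactly one unit, while crossings with the middle wire take no time. *)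
Lemma mid_clock_bounds n d w Q xi s t : 1 <= n -> alternating n d w ->
  adapted_to n w Q xi -> s <= t <= size w ->
  (mid_clock n w xi t <= mid_clock n w xi s)%R /\
  (mid_clock n w xi s + (stage n d (take s w))%:Z <=
   mid_clock n w xi t + (stage n d (take t w))%:Z)%R.
Proof.
move=> n1 rw H /andP[]; elim: t => [|t IHt]; first by rewrite leqn0 => /eqP->.
rewrite leq_eqVlt => /orP[/eqP-> //|st] ts.
have [h1 h2] := IHt st (ltnW ts).
rewrite (mid_clock_step n1 rw H ts) (stage_step _ _ ts).
by case: (central _ _); case: (_ != _) => /=; lia.
Qed.

(** The stages between a letter n and the following letter n+2. *)
Definition upward (s : nat) : bool := (s %% 4 == 1) || (s %% 4 == 2).

Lemma ascending_mid n f : 1 <= n -> ascending n.*2 f n = (f n < f n.+1)%R.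
Proof. by move=> n1; rewrite /ascending -addnn; lia. Qed.

(** A letter n is a peak before it is read and has dropped below n+1 afterwards, and
    conversely for n+2. *)
Lemma upward_central n d w Q xi t : 1 <= n -> alternating n d w -> adapted_to n w Q xi ->
  t < size w -> central n (nth 0 w t) -> nth 0 w t != n.+1 ->
  (heights n w xi t n < heights n w xi t n.+1)%R = upward (stage n d (take t w)) /\
  (heights n w xi t.+1 n < heights n w xi t.+1 n.+1)%R =
    upward (stage n d (take t.+1 w)).
Proof.
move=> n1 rw H ts ci nmid; have pk := heights_peak H ts nmid.
rewrite stage_step // !(heights_step xi ts nmid) ci.
have := mid_pattern_cases ci (alternating_letter rw ts ci).
move: pk nmid; rewrite /upward.
set i := nth 0 w t; set f := heights _ _ _ _ => -[pk1 pk2 pk3] ni.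
case=> -[iE sE]; try by rewrite iE eqxx in ni.
  move: pk2 pk3; rewrite iE minus_res_low // lower_eq lower_neq; last by lia.
  by move=> _ ->; lia.
move: pk2 pk3; rewrite iE minus_res_high //= lower_eq lower_neq; last by lia.
by move=> -> //; lia.
Qed.

Lemma upward_agrees_step n d w Q xi t : 1 <= n -> alternating n d w -> adapted_to n w Q xi ->
  t < size w ->
  ((heights n w xi t n < heights n w xi t n.+1)%R == upward (stage n d (take t w))) =
  ((heights n w xi t.+1 n < heights n w xi t.+1 n.+1)%R ==
     upward (stage n d (take t.+1 w))).
Proof.
move=> n1 rw H ts; case: (boolP (central n (nth 0 w t))) => ci; last first.
  have nmid : nth 0 w t != n.+1 by move: ci; rewrite /central; lia.
  rewrite stage_step // (negPf ci) addn0 !(heights_step xi ts nmid).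
  by rewrite !lower_neq //; move: ci; rewrite /central /minus_res; case: ifP; lia.
have [mid|nmid] := eqVneq (nth 0 w t) n.+1; last first.
  by have [-> ->] := upward_central n1 rw H ts ci nmid; rewrite !eqxx.
rewrite heights_mid // stage_step // ci; congr (_ == _).
by have := mid_pattern_cases ci (alternating_letter rw ts ci); rewrite /upward mid; case=> -[]; lia.
Qed.

(** The comparison of the heights of rows n and n+1 changes exactly at the letters n and
    n+2, so agreement at one moment propagates to the whole word; it holds at the
    letters n and n+2 themselves, and there is such a letter. *)
Lemma upward_ascending n d w Q xi t : 1 <= n -> alternating n d w -> adapted_to n w Q xi ->
  t <= size w -> ascending n.*2 (heights n w xi t) n = upward (stage n d (take t w)).
Proof.
move=> n1 rw H; rewrite ascending_mid //.
(* [B] is constant along w, so one position where it holds is enough. *)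
pose B t := (heights n w xi t n < heights n w xi t n.+1)%R == upward (stage n d (take t w)).
have B0 s : s <= size w -> B s = B 0.
  elim: s => // s IHs ss; rewrite -IHs; last by lia.
  by rewrite /B -(upward_agrees_step n1 rw H).
suff [s ss Bs] : exists2 s, s <= size w & B s.
  by move=> ts; apply/eqP; rewrite -/(B t) B0 // -(B0 s).
(* One of the first two letters of the pattern is n or n+2. *)
have [k k1 ks] : exists2 k, k < 2 & mid_pattern n (d + k) != n.+1.
  have [dE|dE] : d %% 2 = 0 \/ d %% 2 = 1 by lia.
    by exists 0; rewrite // /mid_pattern addn0 dE /=; case: (_ == 0); lia.
  have {}dE : (d + 1) %% 2 = 0 by lia.
  by exists 1; rewrite // /mid_pattern dE /=; case: (_ == 0); lia.
have [_ _ tw] := rw.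
have : mid_pattern n (d + k) \in central_letters n w.
  by rewrite tw; apply/mapP; exists k => //; rewrite mem_iota; lia.
rewrite mem_filter => /andP[ci iw].
exists (index (mid_pattern n (d + k)) w); first exact: index_size.
apply/eqP; apply: (proj1 (upward_central n1 rw H _ _ _)); by rewrite ?index_mem ?nth_index.
Qed.

(** * Intercepts and clocks at crossings *)

(** Twice the row of A_{2n}, where a crossing with the middle wire counts as row
    (2n+1)/2. Doubling keeps half-integers out of the way. *)
Definition double_row (n i : nat) : int :=
  (if i == n.+1 then (n.*2.+1)%:Z else 2 * (minus_res n i)%:Z)%R.

(** Twice the second coordinate of the root of the letter at position t
    ([has_coordE]). *)
Definition double_time (n : nat) (w : seq nat) (xi : nat -> int) (t : nat) : int :=
  (if nth 0%N w t == n.+1 then 2 * mid_clock n w xi t + 1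
   else 2 * heights n w xi t (minus_res n (nth 0%N w t)))%R.

Lemma level_outer_level n d w t x : alternating n d w -> t < size w -> nth 0 w t != n.+1 ->
  let i := nth 0 w t in
  (level (take t w) (bump (mid_level n d) x) == i.-1) = (outer_level n w t x == (minus_res n i).-1)
  /\ (level (take t w) (bump (mid_level n d) x) == i) = (outer_level n w t x == minus_res n i).
Proof.
move=> rw ts nmid i; have [ww _ _] := rw; have /andP[i1 _] := is_word_nth ww ts.
rewrite (level_bump x rw (ltnW ts)) -/(outer_level n w t x) /bump -/i.
have hc := alternating_letter rw ts; rewrite -/i in hc i1 nmid.
have [im|im] := ltnP n.+1 i.
  have := mid_level_above hc im; rewrite minus_res_high //; case: leqP; lia.
have im' : i <= n by lia.
by have := mid_level_below hc im'; rewrite minus_res_low //; case: leqP; lia.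
Qed.

(** At a letter n+1 the middle wire is on one of the levels n, n+1, and the outer wire
    on the other one is on level n once the middle wire is removed. It comes from below
    exactly when it climbs. *)
Lemma level_outer_level_mid n d w t x : alternating n d w -> t < size w -> nth 0 w t = n.+1 ->
  [/\ level (take t w) (bump (mid_level n d) x) = n -> outer_level n w t x = n /\
       upward (stage n d (take t w)) &
     level (take t w) (bump (mid_level n d) x) = n.+1 -> outer_level n w t x = n /\
       upward (stage n d (take t w)) = false].
Proof.
move=> rw ts mid; have c1 : central n n.+1 by rewrite /central; lia.
have hc : n.+1 = mid_pattern n (stage n d (take t w))
  by rewrite -{1}mid (alternating_letter rw ts) // mid.
rewrite (level_bump x rw (ltnW ts)) -/(outer_level n w t x) /bump /upward.
by case: (mid_level_mid hc) => [] [-> [_ ->]] /=; case: leqP; split; lia.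
Qed.

Lemma cross_clock n d w Q xi t x : alternating n d w -> adapted_to n w Q xi -> t < size w ->
  let i := nth 0 w t in
  (level (take t w) (bump (mid_level n d) x) == i.-1) ||
    (level (take t w) (bump (mid_level n d) x) == i) ->
  double_time n w xi t = (2 * wire_clock n w xi t x + (i == n.+1)%:Z)%R.
Proof.
move=> rw H ts i; rewrite /double_time -/i; have [mid|nmid] := eqVneq i n.+1.
  have [h1 h2] := level_outer_level_mid x rw ts mid; rewrite mid /= => hx.
  have px : outer_level n w t x = n by case/orP: hx => /eqP; [move/h1 => []|move/h2 => []].
  by rewrite /wire_clock px.
have [-> ->] := level_outer_level x rw ts nmid => /(wire_clock_cross H ts nmid)[-> _ _].
by rewrite addr0.
Qed.

(** The wire that comes from the lower level climbs through the crossing. *)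
Lemma cross_low n d w Q xi t x : 1 <= n -> alternating n d w -> adapted_to n w Q xi ->
  t < size w -> level (take t w) (bump (mid_level n d) x) = (nth 0 w t).-1 ->
  exists e : int, (2 * wire_intercept n w xi 0 x =
     double_time n w xi t + double_row n (nth 0%N w t) + 4 * (n.*2.+1)%:Z * e)%R.
Proof.
move=> n1 rw H ts lx.
have [e he] := wire_intercept_mod x H (ltnW ts); exists (- e)%R.
suff : (2 * wire_intercept n w xi t x = double_time n w xi t + double_row n (nth 0%N w t))%R.
  by rewrite he => <-; lia.
rewrite /double_time /double_row; case: eqP => [mid|/eqP nmid].
  have [/(_ _)] := level_outer_level_mid x rw ts mid; rewrite lx mid => /(_ erefl)[px up] _.
  rewrite /wire_intercept /mid_clock px /intercept /next_row.
  by rewrite (upward_ascending n1 rw H (ltnW ts)) up; lia.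
have [] := level_outer_level x rw ts nmid; rewrite lx eqxx => /esym/eqP px _.
by rewrite /wire_intercept px (intercept_below (heights_peak H ts nmid)); lia.
Qed.

(** The wire that comes from the upper level descends through the crossing. *)
Lemma cross_high n d w Q xi t x : 1 <= n -> alternating n d w -> adapted_to n w Q xi ->
  t < size w -> level (take t w) (bump (mid_level n d) x) = nth 0 w t ->
  exists e : int, (2 * wire_intercept n w xi 0 x =
     double_time n w xi t - double_row n (nth 0%N w t) + 4 * (n.*2.+1)%:Z * e)%R.
Proof.
move=> n1 rw H ts lx.
have [e he] := wire_intercept_mod x H (ltnW ts); exists (- e)%R.
suff : (2 * wire_intercept n w xi t x = double_time n w xi t - double_row n (nth 0%N w t))%R.
  by rewrite he => h; have := h; lia.
rewrite /double_time /double_row; case: eqP => [mid|/eqP nmid].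
  have [_ /(_ _)] := level_outer_level_mid x rw ts mid; rewrite lx mid => /(_ erefl)[px up].
  rewrite /wire_intercept /mid_clock px /intercept /next_row.
  by rewrite (upward_ascending n1 rw H (ltnW ts)) up; lia.
have [_] := level_outer_level x rw ts nmid; rewrite lx eqxx => /esym/eqP px.
by rewrite /wire_intercept px (intercept_above (heights_peak H ts nmid)); lia.
Qed.

Definition crossed (w : seq nat) (t z y : nat) : bool :=
  (y < z) (+) (level (take t w) y < level (take t w) z).

Lemma crossed_inverted w t z y : z != y ->
  crossed w t z y = inverted (take t w) (minn z y) (maxn z y).
Proof.
rewrite /crossed /inverted => zy; have := @level_inj (take t w) z y.
by case: ltngtP zy => //=; case: ltngtP => //=; lia.
Qed.

Definition crossed_count (m : nat) (w : seq nat) (t z : nat) : nat :=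
  \sum_(y < m.+1) crossed w t z y.

Lemma crossed_mono m w s t z y : full_reversal m w -> z <= m -> y <= m ->
  s <= t <= size w -> crossed w s z y -> crossed w t z y.
Proof.
move=> wf zm ym st; have [->|zy] := eqVneq z y.
  by rewrite /crossed !ltnn.
by rewrite !crossed_inverted //; apply: inverted_mono wf _ st; lia.
Qed.

Lemma crossed_count_mono m w s t z : full_reversal m w -> z <= m -> s <= t <= size w ->
  crossed_count m w s z <= crossed_count m w t z.
Proof.
move=> wf zm st; apply: leq_sum => y _; have ym : y <= m by rewrite -ltnS.
by have := crossed_mono wf zm ym st; case: crossed => // ->.
Qed.

Lemma crossed_count_step m w t z : full_reversal m w -> z <= m -> t < size w ->
  (level (take t w) z == (nth 0 w t).-1) || (level (take t w) z == nth 0 w t) ->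
  crossed_count m w t z < crossed_count m w t.+1 z.
Proof.
move=> wf zm ts lz; have [[ww wr] _] := wf.
have [y ym hy] : exists2 y, y <= m & ~~ crossed w t z y && crossed w t.+1 z y.
  have il := is_word_nth ww ts.
  (* [level] is onto; this provides the wire with which z is exchanged. *)
  have surj l : l <= m -> exists2 y, y <= m & level (take t w) y = l.
    move=> lm; pose x : 'I_m.+1 := weyl m (take t w) (inord l).
    exists x; first by rewrite -ltnS.
    have wt := is_word_take t ww; have xm : x <= m by rewrite -ltnS.
    have e : weyl m (take t w) (inord (level (take t w) x)) = weyl m (take t w) (inord l).
      exact: weyl_level.
    have := congr1 val (perm_inj e); rewrite /= !inordK ?ltnS //.
    exact: level_le.
  have sm : swap (nth 0 w t) (level (take t w) z) <= m.
    by apply: swap_le; [case/andP: il|apply: level_le => //; apply: is_word_take].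
  have [y ym ly] := surj _ sm.
  exists y => //; rewrite /crossed !level_take // ly swapK.
  have := @crosses_ltn _ _ t z y wf zm ym; have := @crosses_ltn _ _ t y z wf ym zm.
  rewrite /crosses ly; case: (swap_cases (nth 0 w t) (level (take t w) z)).
  - move=> [lz' ->] _ /(_ _) h; have {}h : z < y by apply: h.
    by rewrite lz'; lia.
  - move=> [lz' ->] h _; have {}h : y < z by apply: h.
    by rewrite lz'; lia.
  - by case=> ? ?; move: lz; lia.
have yo : y < m.+1 by [].
rewrite /crossed_count (bigD1 (Ordinal yo)) // [X in _ < X](bigD1 (Ordinal yo)) //=.
case/andP: hy => /negPf-> ->; rewrite add0n add1n ltnS; apply: leq_sum => l _.
have lm : l <= m by rewrite -ltnS.
have := crossed_mono wf zm lm (s := t) (t := t.+1).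
by rewrite leqnSn ts => /(_ isT); case: crossed => // ->.
Qed.

Lemma crossed_count_le m w t z : z <= m -> crossed_count m w t z <= m.
Proof.
move=> zm; have zo : z < m.+1 by [].
rewrite /crossed_count (bigD1 (Ordinal zo)) //= {1}/crossed !ltnn /= add0n.
apply: (@leq_trans (\sum_(y < m.+1 | y != Ordinal zo) 1)).
  by apply: leq_sum => y _; case: crossed.
by rewrite sum1_card cardC1 card_ord.
Qed.

(** Each crossing of an outer wire costs at most 2 units of time and adds one wire to
    those it has crossed. As a wire crosses each other wire once, this bounds its
    total running time. *)
Lemma wire_clock_bounds n d w Q xi s t x : alternating n d w -> adapted_to n w Q xi ->
  x <= n.*2 -> s <= t <= size w ->
  let K := fun t => crossed_count n.*2.+1 w t (bump (mid_level n d) x) in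
  (wire_clock n w xi t x <= wire_clock n w xi s x)%R /\
  (wire_clock n w xi s x + 2 * (K s)%:Z <= wire_clock n w xi t x + 2 * (K t)%:Z)%R.
Proof.
move=> rw H xn /andP[+ +] K.
have wf : full_reversal n.*2.+1 w by apply: alternating_full rw _; case: H => [] [].
have Xn : bump (mid_level n d) x <= n.*2.+1 by rewrite /bump; case: leqP; lia.
elim: t => [|t IHt]; first by rewrite leqn0 => /eqP->.
rewrite leq_eqVlt => /orP[/eqP-> //|st] ts.
have [h1 h2] := IHt st (ltnW ts).
have Kt : K t <= K t.+1 by apply: crossed_count_mono; rewrite // leqnSn.
have [mid|nmid] := eqVneq (nth 0 w t) n.+1; first by rewrite wire_clock_mid //; lia.
have [e1 e2] := level_outer_level x rw ts nmid.
set i := minus_res n (nth 0 w t); have [hx|hx] :=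
  boolP ((outer_level n w t x == i.-1) || (outer_level n w t x == i)).
  have [_ b c] := wire_clock_cross H ts nmid hx.
  have : K t < K t.+1 by apply: crossed_count_step; rewrite // e1 e2.
  by lia.
by rewrite wire_clock_other //; move: hx; rewrite -/i negb_or => /andP[? ?] //; lia.
Qed.

(** * Coordinates as times *)

Lemma count_projword n u i : i != n.+1 ->
  count_mem (minus_res n i) (projword n u) = count_mem i u.
Proof.
move=> ni; elim: u => [//|j u IHu].
have -> : projword n (j :: u) =
    if j != n.+1 then minus_res n j :: projword n u else projword n u.
  by rewrite /projword /=; case: ifP.
have [->|nj] /= := eqVneq j n.+1; first by rewrite IHu eq_sym (negPf ni).
rewrite IHu; congr (nat_of_bool _ + _).
by rewrite /minus_res; do 2!case: ltnP => ?; lia.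
Qed.

Lemma coord_outer n w xi (g : posroot n.*2.+1) k r : has_coord w xi g k r ->
  residue w g != n.+1 ->
  k = residue w g /\ r = ((double_time n w xi (pos w g))%:~R / 2)%R.
Proof.
rewrite /double_time -/(residue w g) => hc nmid; rewrite (negPf nmid).
have E : heights n w xi (pos w g) (minus_res n (residue w g)) =
    (xi (minus_res n (residue w g)) - (2 * rank w g)%:Z)%R.
  by rewrite /heights /height count_projword // /rank PoszM.
rewrite E; case: hc nmid {E} => {k r} [h _|h _|h j p -> |h j p ->]; rewrite ?eqxx //.
- by split=> //; rewrite minus_res_low; [rewrite intrM mulrC mulKf|lia].
- by split=> //; rewrite minus_res_high; [rewrite intrM mulrC mulKf|lia].
Qed.

(** The two letters differ in type, so an even number of letters of the pattern lies
    between them; any two consecutive ones would include a letter n+1. *)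
Lemma stage_still n d w s t : alternating n d w -> s < t < size w ->
  central n (nth 0 w s) -> central n (nth 0 w t) ->
  (nth 0 w s == n.+1) != (nth 0 w t == n.+1) ->
  (forall u, s < u < t -> nth 0 w u <> n.+1) ->
  stage n d (take t w) = stage n d (take s.+1 w).
Proof.
move=> rw /andP[st tw] cs ct hst hn.
pose S u := stage n d (take u w).
have par u : u < size w -> central n (nth 0 w u) -> (nth 0 w u == n.+1) = (S u %% 2 == 1).
  move=> uw cu; have := mid_pattern_cases cu (alternating_letter rw uw cu); rewrite -/(S u).
  by case=> -[-> ?]; lia.
have Su u : u < size w -> S u.+1 = S u + central n (nth 0 w u) by exact: stage_step.
(* Without a letter n+1 the stage cannot leave the next odd value. *)
have key u : s < u <= t -> S u = S s.+1 \/ S s.+1 %% 2 = 0 /\ S u = (S s.+1).+1.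
  elim: u => // u IHu /andP[su ut]; have [e|su'] := eqVneq u s; first by left; rewrite e.
  have uw : u < size w by lia.
  have /IHu IH : s < u <= t by lia.
  have := Su u uw; have := par u uw; have : nth 0 w u <> n.+1 by apply: hn; lia.
  by case: (central n _) => /= [h /(_ isT)|_ _]; lia.
have sw : s < size w by lia.
have := key t; have := par t tw ct; have := par s sw cs; have := Su s sw.
rewrite cs -/(S t) -/(S s.+1); lia.
Qed.

Lemma mid_clock_still n d w Q xi s t : 1 <= n -> alternating n d w -> adapted_to n w Q xi ->
  s < t < size w -> central n (nth 0 w s) -> central n (nth 0 w t) ->
  (nth 0 w s == n.+1) != (nth 0 w t == n.+1) ->
  (forall u, s < u < t -> nth 0 w u <> n.+1) ->
  mid_clock n w xi t = mid_clock n w xi s.+1.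
Proof.
move=> n1 rw H st cs ct hst hn; have e := stage_still rw st cs ct hst hn.
have st' : s.+1 <= t <= size w by lia.
have := mid_clock_bounds n1 rw H st'; rewrite e; lia.
Qed.

Lemma mid_clock_peak n w Q xi t : 1 <= n -> adapted_to n w Q xi -> t < size w ->
  central n (nth 0 w t) -> nth 0 w t != n.+1 ->
  mid_clock n w xi t = heights n w xi t (minus_res n (nth 0 w t)).
Proof.
move=> n1 H ts ci nmid; have pk := heights_peak H ts nmid; rewrite /mid_clock.
have [e|e] : nth 0 w t = n \/ nth 0 w t = n.+2 by move: ci nmid; rewrite /central; lia.
  by rewrite e minus_res_low // in pk *; rewrite clock_above.
by rewrite e minus_res_high //= in pk *; rewrite -(clock_below pk).
Qed.

Lemma adjacent_mid n i : adjacent i n.+1 -> central n i /\ i != n.+1.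
Proof. by rewrite /adjacent /central; lia. Qed.

Lemma coord_inner_in n d w Q xi (g h : posroot n.*2.+1) : 1 <= n -> alternating n d w ->
  adapted_to n w Q xi -> residue w g = n.+1 -> arrow w h g ->
  pos w h < size w -> double_time n w xi (pos w g) = (double_time n w xi (pos w h) + 1)%R.
Proof.
move=> n1 rw H rg [adj gh nog noh] hw; rewrite /residue in rg.
rewrite rg in adj nog; have [ch nh] := adjacent_mid adj.
have cg : central n (nth 0 w (pos w g)) by rewrite rg /central; lia.
have gw := ltn_trans gh hw.
rewrite /double_time rg eqxx (negPf nh) -(mid_clock_peak n1 H hw ch nh).
have st : pos w g < pos w h < size w by rewrite gh.
have ne : (nth 0 w (pos w g) == n.+1) != (nth 0 w (pos w h) == n.+1).
  by rewrite rg eqxx (negPf nh).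
rewrite (mid_clock_still n1 rw H st cg ch ne nog).
by rewrite (mid_clock_step n1 rw H gw) rg eqxx andbF; lia.
Qed.

Lemma coord_inner_out n d w Q xi (g h : posroot n.*2.+1) : 1 <= n -> alternating n d w ->
  adapted_to n w Q xi -> residue w g = n.+1 -> arrow w g h ->
  pos w g < size w -> double_time n w xi (pos w g) = (double_time n w xi (pos w h) - 1)%R.
Proof.
move=> n1 rw H rg [adj hg noh nog] gw; rewrite /residue in rg.
have adj' : adjacent (nth 0 w (pos w h)) n.+1 by move: adj; rewrite rg /adjacent orbC.
rewrite rg in nog; have [ch nh] := adjacent_mid adj'.
have cg : central n (nth 0 w (pos w g)) by rewrite rg /central; lia.
have hw := ltn_trans hg gw.
rewrite /double_time rg eqxx (negPf nh) -(mid_clock_peak n1 H hw ch nh).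
have st : pos w h < pos w g < size w by rewrite hg.
have ne : (nth 0 w (pos w h) == n.+1) != (nth 0 w (pos w g) == n.+1).
  by rewrite rg eqxx (negPf nh).
rewrite (mid_clock_still n1 rw H st ch cg ne nog).
by rewrite (mid_clock_step n1 rw H hw) ch nh; lia.
Qed.

(** The neighbour through which the coordinate of a root of residue n+1 is defined is
    the adjacent letter n or n+2 of the pattern, so both ways to define it give the
    clock of the outer wire that crosses the middle wire, plus 1/2. *)
Lemma has_coordE n d w Q xi (g : posroot n.*2.+1) k r : 1 <= n -> alternating n d w ->
  adapted_to n w Q xi -> has_coord w xi g k r ->
  k = residue w g /\ r = ((double_time n w xi (pos w g))%:~R / 2)%R.
Proof.
move=> n1 rw H; have wf : full_reversal n.*2.+1 w.
  by apply: alternating_full rw _; case: H => [] [].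
have pw (h : posroot n.*2.+1) : pos w h < size w by case: (pos_crosses h (proj1 wf)).
have [rg|rg] := eqVneq (residue w g) n.+1; last by move=> /coord_outer; apply.
case=> {k r} [|||]; rewrite ?rg; [lia|lia|..] => h j p _ a hc; split=> //.
  have nh : residue w h != n.+1.
    by have [+ _ _ _] := a; rewrite -!/(residue w _) rg => /adjacent_mid[].
  have [_ ->] := coord_outer hc nh.
  by rewrite (coord_inner_in n1 rw H rg a (pw h)) intrD mulrDl.
have nh : residue w h != n.+1.
  by have [+ _ _ _] := a; rewrite -!/(residue w _) rg /adjacent orbC => /adjacent_mid[].
have [_ ->] := coord_outer hc nh.
by rewrite (coord_inner_out n1 rw H rg a (pw g)) intrB mulrBl.
Qed.

(** * Three wires crossing pairwise *)

(** Adding the congruences gives i + j = k modulo h, so i + j is k or k + h. The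
    bounds on p, q, r fix the multiples of h: i + j = k + h would require
    p - q >= 3h + k. *)
Lemma outer_pair_arith (h i j k p q r e1 e2 e3 : int) :
  (0 < i < h)%R -> (0 < j < h)%R -> (0 < k < h)%R ->
  (p + i = r + k + 2 * h * e1)%R -> (q - j = r - k + 2 * h * e2)%R ->
  (p - i = q + j + 2 * h * e3)%R -> (q < r < p)%R -> (p - q <= 2 * h)%R ->
  (i + j = k /\ p - r = j /\ r - q = i)%R.
Proof.
move=> hi hj hk E1 E2 E3 qrp pq.
have E : (h * (e1 - e2 - e3) = i + j - k)%R by lia.
have e01 : (e1 - e2 - e3 = 0 \/ e1 - e2 - e3 = 1)%R by nia.
have e1b : (0 <= e1)%R by nia.
have e2b : (e2 <= 0)%R by nia.
have [e|e] := e01.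
  have z1 : (e1 = 0)%R by nia.
  have z2 : (e2 = 0)%R by nia.
  by move: E E1 E2; rewrite e z1 z2 !mulr0; lia.
have : (1 <= e1)%R by nia.
have : (e2 <= -1)%R by nia.
by nia.
Qed.
(** The congruences put p and q at distance k - h/2 on either side of r up to multiples
    of 2h, and nonzero multiples are excluded by the bound on p - q. Here [k], [p],
    [q] and [r] are doubled. *)
Lemma inner_pair_arith (h k p q r e1 e2 : int) :
  (0 < k < 2 * h)%R -> (k <> h) ->
  (p + h = r + k + 4 * h * e1)%R -> (q - h = r - k + 4 * h * e2)%R ->
  (q < r < p)%R -> (p - q <= 4 * h)%R -> (p + q = 2 * r)%R.
Proof.
move=> hk nk E1 E2 qrp pq.
have e1b : (0 <= e1)%R by nia.
have e2b : (e2 <= 0)%R by nia.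
have : (e1 - e2 <= 1)%R by nia.
have [e|e] : (e1 = 0 \/ 1 <= e1)%R by lia.
  have [e'|e'] : (e2 = 0 \/ e2 <= -1)%R by lia.
    by move: E1 E2; rewrite e e'; lia.
  move: E1; rewrite e; nia.
have [e'|e'] : (e2 = 0 \/ e2 <= -1)%R by lia.
  move: E2; rewrite e'; nia.
by lia.
Qed.

Definition meets (w : seq nat) (t x : nat) : bool :=
  (level (take t w) x == (nth 0 w t).-1) || (level (take t w) x == nth 0 w t).

Lemma crosses_meets w t x y : crosses w t x y -> meets w t x /\ meets w t y.
Proof. by rewrite /meets => -[_ -> ->]; rewrite !eqxx orbT. Qed.

Lemma outer_letter n d w t x y : alternating n d w ->
  crosses w t (bump (mid_level n d) x) (bump (mid_level n d) y) -> nth 0 w t != n.+1.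
Proof.
move=> rw [ts lx ly]; apply/eqP => mid.
have [h1 _] := level_outer_level_mid x rw ts mid; have [_ h2] := level_outer_level_mid y rw ts mid.
rewrite lx mid in h1; rewrite ly mid in h2.
by have [_ up] := h1 erefl; have [_] := h2 erefl; rewrite up.
Qed.

Lemma inner_letter n d w t : alternating n d w -> t < size w -> meets w t (mid_level n d) ->
  nth 0 w t = n.+1.
Proof.
move=> rw ts; rewrite /meets (level_mid_wire rw (ltnW ts)) => hm.
have [ww _ _] := rw; have /andP[i1 _] := is_word_nth ww ts.
have hc := alternating_letter rw ts; have [im|im|//] := ltngtP (nth 0 w t) n.+1.
  by have := mid_level_below hc im; lia.
by have := mid_level_above hc im; lia.
Qed.

(** A crossing of two outer wires takes time, while one with the middle wire is placed
    half a unit before the next outer crossing; this is why one of the two crossings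
    has to be outer. *)
Lemma time_decreases n d w Q xi s t x : alternating n d w -> adapted_to n w Q xi ->
  x <= n.*2 -> let X := bump (mid_level n d) x in
  s < t < size w -> meets w s X -> meets w t X ->
  (nth 0 w s != n.+1) || (nth 0 w t != n.+1) ->
  (double_time n w xi t < double_time n w xi s)%R.
Proof.
move=> rw H xn X /andP[st ts] ms mt hmid; have sw := ltn_trans st ts.
rewrite (cross_clock rw H sw ms) (cross_clock rw H ts mt).
have [nmid|mid] := boolP (nth 0 w s != n.+1).
  have [e1 e2] := level_outer_level x rw sw nmid.
  have ms' := ms; rewrite /meets e1 e2 in ms'.
  have [_ b _] := wire_clock_cross H sw nmid ms'.
  have st' : s.+1 <= t <= size w by rewrite st ltnW.
  have [c _] := wire_clock_bounds rw H xn st'.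
  by rewrite (negPf nmid) /=; case: (_ == n.+1); lia.
rewrite (negPf mid) /= in hmid; rewrite negbK in mid.
have st' : s <= t <= size w by lia.
have [c _] := wire_clock_bounds rw H xn st'.
by rewrite mid (negPf hmid); lia.
Qed.

Lemma outer_time_bound n d w Q xi s t x : alternating n d w -> adapted_to n w Q xi ->
  x <= n.*2 -> let X := bump (mid_level n d) x in
  s < t < size w -> meets w s X -> meets w t X ->
  nth 0 w s != n.+1 -> nth 0 w t != n.+1 ->
  (double_time n w xi s - double_time n w xi t <= 4 * (n.*2.+1)%:Z)%R.
Proof.
move=> rw H xn X /andP[st ts] ms mt ns nt; have sw := ltn_trans st ts.
rewrite (cross_clock rw H sw ms) (cross_clock rw H ts mt) (negPf ns) (negPf nt) !addr0.
have st' : s <= t <= size w by lia.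
have [_] := wire_clock_bounds rw H xn st'.
have wf : full_reversal n.*2.+1 w by apply: alternating_full rw _; case: H => [] [].
have Xn : X <= n.*2.+1 by rewrite /X /bump; case: leqP; lia.
have := crossed_count_step wf Xn ts mt; have := crossed_count_le w t.+1 Xn; rewrite -/X.
by lia.
Qed.

(** Two crossings with the middle wire share no outer wire, so the bound comes from
    the number of letters n and n+2. *)
Lemma inner_time_bound n d w Q xi s t : 1 <= n -> alternating n d w ->
  adapted_to n w Q xi -> s < t < size w -> nth 0 w s = n.+1 -> nth 0 w t = n.+1 ->
  (double_time n w xi s - double_time n w xi t <= 4 * (n.*2.+1)%:Z)%R.
Proof.
move=> n1 rw H /andP[st ts] ms mt; rewrite /double_time ms mt eqxx.
have st' : s <= t <= size w by lia.
have [_ h] := mid_clock_bounds n1 rw H st'.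
have : size (central_letters n (take t w)) <= n.*2.+1.*2.
  have [_ _ tw] := rw; rewrite -(size_mkseq (fun j => mid_pattern n (d + j)) n.*2.+1.*2) -tw.
  rewrite -[X in _ <= size (central_letters n X)](cat_take_drop t w).
  by rewrite /central_letters filter_cat size_cat leq_addr.
by move: h; rewrite /stage; lia.
Qed.

(** The conclusion for residues [i], [j], [k] and doubled times [a], [b], [g]. The
    second alternative is Dorey's rule in type A_{2n}. *)
Definition dorey_rule (n i j k : nat) (a b g : int) : Prop :=
  ([/\ i = n.+1, j = n.+1 & a + b = 2 * g]
   \/ [/\ a - g = 2 * `|(minus_res n k)%:Z - (minus_res n i)%:Z|,
          b - g = - 2 * `|(minus_res n k)%:Z - (minus_res n j)%:Z| &
         (minus_res n i)%:Z + (minus_res n j)%:Z = (minus_res n k)%:Z \/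
         (minus_res n i)%:Z + (minus_res n j)%:Z
           = (minus_res n k)%:Z + (n.*2.+1)%:Z])%R.

Lemma mid_wire_or_bump n d x : x <= n.*2.+1 ->
  x = mid_level n d \/ exists2 y, y <= n.*2 & x = bump (mid_level n d) y.
Proof.
move=> xn; have [|xc] := eqVneq x (mid_level n d); [by left|right].
exists (unbump (mid_level n d) x); last by rewrite unbumpK.
have : n <= mid_level n d <= n.+1 by rewrite /mid_level; case: ifP; lia.
by rewrite /unbump; case: ltngtP xc; lia.
Qed.

Lemma outer_row n d w t : alternating n d w -> t < size w -> nth 0 w t != n.+1 ->
  (0 < (minus_res n (nth 0%N w t))%:Z < (n.*2.+1)%:Z)%R.
Proof.
move=> [ww _ _] ts nmid; have := is_word_nth ww ts.
have [im|im] := ltnP n.+1 (nth 0 w t); first by rewrite minus_res_high //; lia.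
by rewrite minus_res_low //; lia.
Qed.

Lemma cross_outer n d w Q xi t x y : 1 <= n -> alternating n d w -> adapted_to n w Q xi ->
  crosses w t (bump (mid_level n d) x) (bump (mid_level n d) y) ->
  let p := heights n w xi t (minus_res n (nth 0 w t)) in
  let i := (minus_res n (nth 0%N w t))%:Z%R in
  [/\ (0 < i < (n.*2.+1)%:Z)%R, double_time n w xi t = (2 * p)%R,
    exists e : int, (wire_intercept n w xi 0 x = p + i + 2 * (n.*2.+1)%:Z * e)%R &
    exists e : int, (wire_intercept n w xi 0 y = p - i + 2 * (n.*2.+1)%:Z * e)%R].
Proof.
move=> n1 rw H cxy p i; have nmid := outer_letter rw cxy; have [ts lx ly] := cxy.
have tE : double_time n w xi t = (2 * p)%R by rewrite /double_time (negPf nmid).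
have rE : double_row n (nth 0 w t) = (2 * i)%R by rewrite /double_row (negPf nmid).
have [e1] := cross_low n1 rw H ts lx; have [e2] := cross_high n1 rw H ts ly.
rewrite tE rE => E2 E1; split => //; first exact: outer_row rw ts nmid.
  by exists e1; lia.
by exists e2; lia.
Qed.

(** The wires x and y are in row h/2 at the same distance in time from their own
    crossing, one before it and one after it. *)
Lemma inner_pair n d w Q xi ta tb tg x y : 1 <= n -> alternating n d w -> adapted_to n w Q xi ->
  let c := mid_level n d in let X := bump c x in let Y := bump c y in
  x <= n.*2 -> y <= n.*2 -> ta < tg < tb -> crosses w tg X Y ->
  crosses w ta X c /\ crosses w tb c Y \/ crosses w ta c Y /\ crosses w tb X c ->
  (double_time n w xi ta + double_time n w xi tb = 2 * double_time n w xi tg)%R.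
Proof.
move=> n1 rw H c X Y xn yn /andP[ag gb] cg cab.
have ng := outer_letter rw cg; have [tgs lgx lgy] := cg; have [mgx mgy] := crosses_meets cg.
have [tbs tas] : tb < size w /\ ta < size w by case: cab => -[[? _ _] [? _ _]].
have ma : nth 0 w ta = n.+1.
  by apply: (inner_letter rw tas); case: cab => -[/crosses_meets[? ?] _].
have mb : nth 0 w tb = n.+1.
  by apply: (inner_letter rw tbs); case: cab => -[_ /crosses_meets[? ?]].
have pq : (double_time n w xi ta - double_time n w xi tb <= 4 * (n.*2.+1)%:Z)%R.
  by apply: (inner_time_bound n1 rw H) => //; rewrite (ltn_trans ag).
have dec s t z : z <= n.*2 -> s < t < size w -> meets w s (bump c z) ->
    meets w t (bump c z) -> (nth 0 w s != n.+1) || (nth 0 w t != n.+1) ->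
    (double_time n w xi t < double_time n w xi s)%R.
  by move=> h1 h2 h3 h4; apply: time_decreases rw H h1 h2 h3 h4.
have [e1 E1] := cross_low n1 rw H tgs lgx; have [e2 E2] := cross_high n1 rw H tgs lgy.
have row_g := outer_row rw tgs ng.
have rg : double_row n (nth 0 w tg) = (2 * (minus_res n (nth 0%N w tg))%:Z)%R.
  by rewrite /double_row (negPf ng).
have rm : double_row n n.+1 = Posz n.*2.+1 by rewrite /double_row eqxx.
have st1 : ta < tg < size w by rewrite ag.
have st2 : tg < tb < size w by rewrite gb.
rewrite rg in E1 E2; set K := minus_res n _ in row_g E1 E2.
case: cab => -[ca cb]; have [_ la1 la2] := ca; have [_ lb1 lb2] := cb.
  have [e3 E3] := cross_low n1 rw H tas la1; have [e4 E4] := cross_high n1 rw H tbs lb2.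
  rewrite ma rm in E3; rewrite mb rm in E4.
  have [max _] := crosses_meets ca; have [_ mby] := crosses_meets cb.
  have d1 := dec _ _ _ xn st1 max mgx; rewrite ng orbT in d1.
  have d2 := dec _ _ _ yn st2 mgy mby; rewrite ng in d2.
  apply: (@inner_pair_arith (Posz n.*2.+1) (2 * K%:Z)%R _ _ _
    (e1 - e3)%R (e2 - e4)%R) => //; lia.
have [e3 E3] := cross_high n1 rw H tas la2; have [e4 E4] := cross_low n1 rw H tbs lb1.
rewrite ma rm in E3; rewrite mb rm in E4.
have [_ may] := crosses_meets ca; have [mbx _] := crosses_meets cb.
have d1 := dec _ _ _ yn st1 may mgy; rewrite ng orbT in d1.
have d2 := dec _ _ _ xn st2 mgx mbx; rewrite ng in d2.
apply: (@inner_pair_arith (Posz n.*2.+1)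
  (2 * (n.*2.+1)%:Z - 2 * K%:Z)%R _ _ _
  (e2 - e3)%R (e1 - e4)%R) => //; lia.
Qed.

(** The wire z descends where it crosses x and climbs where it crosses y. If the
    crossing with x comes first, z is reflected at row 0 in between and i + j = k;
    otherwise it is reflected at row h, and the complementary rows h - i, h - j, h - k
    satisfy this equation. *)
Lemma outer_pair n d w Q xi ta tb tg x y z : 1 <= n -> alternating n d w -> adapted_to n w Q xi ->
  let c := mid_level n d in let X := bump c x in let Y := bump c y in let Z := bump c z in
  x <= n.*2 -> y <= n.*2 -> z <= n.*2 -> ta < tg < tb -> crosses w tg X Y ->
  crosses w ta X Z /\ crosses w tb Z Y \/ crosses w ta Z Y /\ crosses w tb X Z ->
  dorey_rule n (nth 0 w ta) (nth 0 w tb) (nth 0 w tg)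
    (double_time n w xi ta) (double_time n w xi tb) (double_time n w xi tg).
Proof.
move=> n1 rw H c X Y Z xn yn zn /andP[ag gb] cg cab; right.
have [mgx mgy] := crosses_meets cg; have ng := outer_letter rw cg.
have [tgs _ _] := cg.
have [tbs tas] : tb < size w /\ ta < size w by case: cab => -[[? _ _] [? _ _]].
have st1 : ta < tg < size w by rewrite ag.
have st2 : tg < tb < size w by rewrite gb.
have st3 : ta < tb < size w by rewrite (ltn_trans ag).
have [hk -> [e1 E1] [e2 E2]] := cross_outer n1 rw H cg.
have dec s t u : u <= n.*2 -> s < t < size w -> meets w s (bump c u) ->
    meets w t (bump c u) -> (nth 0 w s != n.+1) || (nth 0 w t != n.+1) ->
    (double_time n w xi t < double_time n w xi s)%R.
  by move=> h1 h2 h3 h4; apply: time_decreases rw H h1 h2 h3 h4.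
have bnd s t u : u <= n.*2 -> s < t < size w -> meets w s (bump c u) ->
    meets w t (bump c u) -> nth 0 w s != n.+1 -> nth 0 w t != n.+1 ->
    (double_time n w xi s - double_time n w xi t <= 4 * (n.*2.+1)%:Z)%R.
  by move=> h1 h2 h3 h4; apply: outer_time_bound rw H h1 h2 h3 h4.
case: cab => -[ca cb]; have [ma1 ma2] := crosses_meets ca; have [mb1 mb2] := crosses_meets cb.
  have b := bnd _ _ _ zn st3 ma2 mb1 (outer_letter rw ca) (outer_letter rw cb).
  have d1 := dec _ _ _ xn st1 ma1 mgx; rewrite ng orbT in d1.
  have d2 := dec _ _ _ yn st2 mgy mb2; rewrite ng in d2.
  have {}d1 := d1 isT; have {}d2 := d2 isT; move: b d1 d2.
  have [hi -> [e3 E3] [e4 E4]] := cross_outer n1 rw H ca.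
  have [hj -> [e5 E5] [e6 E6]] := cross_outer n1 rw H cb.
  have [_ -> _ _] := cross_outer n1 rw H cg.
  move: hi hj hk E1 E2 E3 E4 E5 E6; set I := minus_res n _; set J := minus_res n _.
  set K := minus_res n _ => hi hj hk E1 E2 E3 E4 E5 E6 b d1 d2.
  have [] := @outer_pair_arith _ _ _ _ (heights n w xi ta I) (heights n w xi tb J)
    (heights n w xi tg K) (e1 - e3)%R (e2 - e6)%R (e5 - e4)%R hi hj hk; [lia..|].
  by move=> IJ [f1 f2]; split; lia.
have b := bnd _ _ _ zn st3 ma1 mb2 (outer_letter rw ca) (outer_letter rw cb).
have d1 := dec _ _ _ yn st1 ma2 mgy; rewrite ng orbT in d1.
have d2 := dec _ _ _ xn st2 mgx mb1; rewrite ng in d2.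
have {}d1 := d1 isT; have {}d2 := d2 isT; move: b d1 d2.
have [hi -> [e3 E3] [e4 E4]] := cross_outer n1 rw H ca.
have [hj -> [e5 E5] [e6 E6]] := cross_outer n1 rw H cb.
have [_ -> _ _] := cross_outer n1 rw H cg.
move: hi hj hk E1 E2 E3 E4 E5 E6; set I := minus_res n _; set J := minus_res n _.
set K := minus_res n _ => hi hj hk E1 E2 E3 E4 E5 E6 b d1 d2.
(* The reflection i |-> h - i exchanges climbing and descending wires. *)
have [] := @outer_pair_arith (Posz n.*2.+1) (Posz n.*2.+1 - Posz I)%R
  (Posz n.*2.+1 - Posz J)%R (Posz n.*2.+1 - Posz K)%R
  (heights n w xi ta I) (heights n w xi tb J)
  (heights n w xi tg K) (e2 - e4)%R (e1 - e5)%R (e6 - e3 - 1)%R; [lia..|].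
by move=> IJ [f1 f2]; split; lia.
Qed.

Lemma pair_dorey_rule n d w Q xi ta tb tg X Y Z : 1 <= n -> alternating n d w ->
  adapted_to n w Q xi -> X < Z -> Z < Y -> Y <= n.*2.+1 ->
  crosses w tg X Y -> nth 0 w tg != n.+1 -> ta < tb ->
  crosses w ta X Z /\ crosses w tb Z Y \/ crosses w ta Z Y /\ crosses w tb X Z ->
  dorey_rule n (nth 0 w ta) (nth 0 w tb) (nth 0 w tg)
    (double_time n w xi ta) (double_time n w xi tb) (double_time n w xi tg).
Proof.
move=> n1 rw H XZ ZY Yn cg ng ab cab.
have wf : full_reversal n.*2.+1 w by apply: alternating_full rw _; case: H => [] [].
have agb : ta < tg < tb.
  by case: cab => -[ca cb]; [have := crosses_convex wf XZ ZY Yn cg ca cb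
                            |have := crosses_convex wf XZ ZY Yn cg cb ca]; lia.
have [mx my] := crosses_meets cg; have [tgs _ _] := cg.
have outer V : V <= n.*2.+1 -> meets w tg V ->
    exists2 v, v <= n.*2 & V = bump (mid_level n d) v.
  move=> Vn mV; case: (@mid_wire_or_bump n d V Vn) => // VE.
  by move: ng; rewrite (inner_letter rw tgs) ?eqxx // -VE.
have Xn : X <= n.*2.+1 by lia.
have [x xn XE] := outer X Xn mx; have [y yn YE] := outer Y Yn my; subst X Y.
have Zn : Z <= n.*2.+1 by lia.
case: (@mid_wire_or_bump n d Z Zn) => [ZE|[z zn ZE]].
  subst Z; left; have tab : ta < size w /\ tb < size w.
    by case: cab => -[[? _ _] [? _ _]].
  split; last exact: (inner_pair n1 rw H xn yn agb cg cab).
    by apply: (inner_letter rw); case: cab tab => -[/crosses_meets[? ?] ?] [].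
  by apply: (inner_letter rw); case: cab tab => -[? /crosses_meets[? ?]] [].
by subst Z; apply: (outer_pair n1 rw H xn yn zn agb cg cab).
Qed.

(** * Sums of positive roots *)

Lemma interval_sum_left (m a1 a2 b1 b2 g1 g2 : nat) :
  a1 < a2 <= m -> b1 < b2 <= m -> g1 < g2 <= m ->
  (forall l, l < m -> (a1 <= l < a2) + (b1 <= l < b2) = (g1 <= l < g2)) ->
  a1 <= g1 < a2 -> [/\ a1 = g1, a2 = b1 & b2 = g2].
Proof.
move=> ha hb hg H hga.
have e1 : a1 = g1 by move: (H a1); clear -ha hg hga; lia.
have le_ab : a2 <= b1.
  move: (H b1) (H a1); clear -ha hb e1; case: (leqP a2 b1) => //; lia.
have le_bg : b2 <= g2 by move: (H b2.-1); clear -hb hg; lia.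
have e2 : a2 = b1 by move: (H a2); clear -ha hb hg e1 le_ab le_bg; lia.
have e3 : b2 = g2 by move: (H g2.-1); clear -ha hb hg le_ab le_bg; lia.
by [].
Qed.

Lemma interval_sum (m a1 a2 b1 b2 g1 g2 : nat) :
  a1 < a2 <= m -> b1 < b2 <= m -> g1 < g2 <= m ->
  (forall l, l < m -> (a1 <= l < a2) + (b1 <= l < b2) = (g1 <= l < g2)) ->
  [/\ a1 = g1, a2 = b1 & b2 = g2] \/ [/\ b1 = g1, b2 = a1 & a2 = g2].
Proof.
move=> ha hb hg H.
have : a1 <= g1 < a2 \/ b1 <= g1 < b2 by move: (H g1); clear -hg; lia.
case; [left|right]; first exact: interval_sum_left H _.
by apply: (interval_sum_left hb ha hg) => // l /H <-; rewrite addnC.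
Qed.

Lemma root_sum m (a b g : posroot m) : (rootvec a + rootvec b)%R = rootvec g ->
  [/\ (val a).1 = (val g).1, (val a).2 = (val b).1 & (val b).2 = (val g).2] \/
  [/\ (val b).1 = (val g).1, (val b).2 = (val a).1 & (val a).2 = (val g).2].
Proof.
move=> E; have bd (h : posroot m) : (val h).1 < (val h).2 <= m.
  by rewrite (valP h) -ltnS ltn_ord.
have := interval_sum (bd a) (bd b) (bd g) _.
case=> [l lm|[e1 e2 e3]|[e1 e2 e3]]; [|left|right]; try by split; apply: val_inj.
have := congr1 (fun v : 'rV_m => v ord0 (Ordinal lm)) E; rewrite !mxE /coef /=; lia.
Qed.

(** * The coordinates of a pair *)

Lemma dorey_rule_rat n i j k (A B G : int) : dorey_rule n i j k A B G ->
  let i' : rat := (minus_res n i)%:R%R in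
  let j' : rat := (minus_res n j)%:R%R in
  let k' : rat := (minus_res n k)%:R%R in
  let h : rat := (n.*2.+1)%:R%R in
  let p : rat := (A%:~R / 2)%R in let q : rat := (B%:~R / 2)%R in
  let r : rat := (G%:~R / 2)%R in
  ([/\ i = n.+1, j = n.+1 & p + q = 2 * r]
   \/ [/\ p - r = `|k' - i'|, q - r = - `|k' - j'| &
         i' + j' = k' \/ (h - i') + (h - j') = h - k'])%R.
Proof.
move=> F i' j' k' h p q r; have toZ (x : nat) : (x%:R = x%:Z%:~R :> rat)%R by [].
rewrite /i' /j' /k' /h !toZ -!intrB -!intr_norm /p /q /r.
case: F => [[-> -> e]|[e1 e2 e3]]; [left|right]; split=> //.
- by rewrite -mulrDl -intrD e intrM; lra.
- by rewrite -mulrBl -intrB e1 intrM; lra.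
- by rewrite -mulrBl -intrB e2 intrM; lra.
by case: e3 => e3; [left|right]; rewrite -!intrD; congr intmul; lia.
Qed.

Theorem lemma6p26 (n : nat) (w : seq nat) (Q : rel nat) (xi : nat -> int)
    (g a b : posroot n.*2.+1) (k i j : nat) (r p q : rat) :
  (1 <= n)%N ->
  twisted_adapted n w ->
  quiver_of n w Q ->
  height_function Q xi ->
  ~ is_simple g ->
  induced w g ->
  has_coord w xi g k r ->
  folded_mult g = 1%N ->
  minimal_pair w g a b ->
  has_coord w xi a i p ->
  has_coord w xi b j q ->
  let i' : rat := (minus_res n i)%:R%R in
  let j' : rat := (minus_res n j)%:R%R in
  let k' : rat := (minus_res n k)%:R%R in
  let h : rat := (n.*2.+1)%:R%R in
  ([/\ i = n.+1, j = n.+1 & p + q = 2 * r]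
   \/ [/\ p - r = `|k' - i'|, q - r = - `|k' - j'| &
         i' + j' = k' \/ (h - i') + (h - j') = h - k'])%R.
Proof.
move=> n1 /(twisted_alternating n1)[d rw] Qw hQ _ ig cg _ [ab_g ab _ _] ca cb.
have H : adapted_to n w Q xi by split.
have wr : reverses n.*2.+1 w by case: (alternating_full rw (let: And3 _ h _ := Qw in h)).
have [-> ->] := has_coordE n1 rw H cg.
have [-> ->] := has_coordE n1 rw H ca.
have [-> ->] := has_coordE n1 rw H cb.
apply: dorey_rule_rat; rewrite /residue.
have xg := pos_crosses g wr; have xa := pos_crosses a wr; have xb := pos_crosses b wr.
have gn : (val g).2 <= n.*2.+1 by rewrite -ltnS.
have ng : nth 0 w (pos w g) != n.+1 by apply/eqP.
have := valP a; have := valP b.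
case: (root_sum ab_g) => -[e1 e2 e3] b12 a12.
  apply: (pair_dorey_rule (Z := (val a).2) n1 rw H _ _ gn xg ng ab); rewrite -?e1 -?e3 //.
    by rewrite e2.
  by left; split=> //; rewrite e2.
apply: (pair_dorey_rule (Z := (val b).2) n1 rw H _ _ gn xg ng ab); rewrite -?e1 -?e3 //.
  by rewrite e2.
by right; split=> //; rewrite e2.
Qed.
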